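(* There exist complete $\mathrm{SO}(4)$-invariant strict symplectic half-flat $\mathrm{SU}(3)$-structures on the tangent bundle $T\mathbb{S}^3$, where $\mathrm{SO}(4)$ acts on $T\mathbb{S}^3\cong\mathrm{SO}(4)\times_{\mathrm{SO}(3)}\mathbb{R}^3$ by the natural cohomogeneity one action induced by its standard transitive action on $\mathbb{S}^3$. That is, there is a strict symplectic half-flat $\mathrm{SU}(3)$-structure $(\omega,\psi)$ on $T\mathbb{S}^3$ such that $\omega$ and $\psi$ are $\mathrm{SO}(4)$-invariant and the induced Riemannian metric $g$ is complete.
   Context: An $\mathrm{SU}(3)$-structure on a six-dimensional smooth manifold $M$ is an almost Hermitian structure $(g,J)$ with fundamental $2$-form $\omega:=g(J\cdot,\cdot)$ together with a complex volume form $\Psi=\psi+i\,\widehat{\psi}$ of type $(3,0)$ (with $\psi,\widehat\psi$ real $3$-forms) such that $\psi\wedge\widehat{\psi}=\frac23\,\omega^3$. The whole data $(g,J,\Psi)$ is determined by the pair $(\omega,\psi)$, so one speaks of the $\mathrm{SU}(3)$-structure $(\omega,\psi)$ and of its induced metric $g$ and almost complex structure $J$. The $\mathrm{SU}(3)$-structure $(\omega,\psi)$ is symplectic half-flat if $d\omega=0$ and $d\psi=0$. In this case there is a unique real $2$-form $\sigma$ of type $(1,1)$ with $\sigma\wedge\omega^2=0$ such that $d\widehat{\psi}=\sigma\wedge\omega$. The structure is called strict if $\sigma$ is not identically zero; equivalently, if $J$ is non-integrable. The $\mathrm{SO}(4)$-action on $T\mathbb{S}^3$ is the one by differentials of the standard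 action of $\mathrm{SO}(4)$ on $\mathbb{S}^3\subset\mathbb{R}^4$. *)

(* Defs.v *)
From HB Require Import structures.
From mathcomp Require Import all_boot all_order all_algebra all_fingroup.
From mathcomp Require Import all_classical all_reals all_analysis.
From mathcomp Require Import complex.
Set Implicit Arguments.
Unset Strict Implicit.
Unset Printing Implicit Defensive.
Import Order.TTheory GRing.Theory Num.Theory.
Import numFieldNormedType.Exports.
Local Open Scope classical_set_scope.
Local Open Scope ring_scope.

(* A closed embedded submanifold of a normed space V is given by its underlying
   set M and its tangent spaces T p `<=` V, p \in M.  Tensor fields on it are
   represented by tensor fields defined and smooth on an open neighbourhood of
   M in V (every smooth tensor field on M has such an extension), and every
   condition imposed on them below is only evaluated at points of M and on
   vectors of T p. *)

(* U is meant to be open; C^n by existence and continuity of iterated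
   directional derivatives. *)
Fixpoint Cn_on (R : realType) (V W : normedModType R) (U : set V) (n : nat)
    (f : V -> W) : Prop :=
  (forall p, U p -> {for p, continuous f}) /\
  match n with
  | 0 => True
  | m.+1 => forall v : V, (forall p, U p -> derivable f p v) /\
                          Cn_on U m (fun p => 'D_v f p)
  end.

Definition smooth_on (R : realType) (V W : normedModType R) (U : set V)
  (f : V -> W) : Prop := forall n, Cn_on U n f.

(* The arguments of a k-form at p are collected in a family w : 'I_k -> V. *)
Definition dform (R : realType) (V : normedModType R) (k : nat) : Type :=
  V -> ('I_k -> V) -> R.

Definition multilinear (R : realType) (V : normedModType R) (k : nat)
    (a : ('I_k -> V) -> R) : Prop :=
  forall (i : 'I_k) (w : 'I_k -> V) (c : R) (u v : V),
    a [eta w with i |-> c *: u + v]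
    = c * a [eta w with i |-> u] + a [eta w with i |-> v].

Definition alternating (R : realType) (V : normedModType R) (k : nat)
    (a : ('I_k -> V) -> R) : Prop :=
  forall (w : 'I_k -> V) (i j : 'I_k), i != j -> w i = w j -> a w = 0.

Definition smooth_form (R : realType) (V : normedModType R) (M : set V)
    (k : nat) (alpha : dform V k) : Prop :=
  exists U : set V, [/\ open U, M `<=` U,
    forall p, U p -> multilinear (alpha p) /\ alternating (alpha p)
    & forall w, smooth_on U (fun p => alpha p w : R^o)].

(* Equality of the restrictions to M. *)
Definition form_eq (R : realType) (V : normedModType R) (M : set V)
    (T : V -> set V) (k : nat) (alpha beta : dform V k) : Prop :=
  forall p (w : 'I_k -> V), M p -> (forall i, T p (w i)) ->
    alpha p w = beta p w.

Definition form0 (R : realType) (V : normedModType R) (k : nat) : dform V k :=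
  fun _ _ => 0.

(* Normalised so that (e1 /\ ... /\ ek)(v1, ..., vk) = det (ei vj). *)
Definition wedge (R : realType) (V : normedModType R) (k l : nat)
    (alpha : dform V k) (beta : dform V l) : dform V (k + l) := fun p w =>
  (k`! * l`!)%:R^-1 *
  \sum_(s : 'S_(k + l)) (-1) ^+ s *
     (alpha p (fun i => w (s (lshift l i))) *
      beta p (fun j => w (s (rshift k j)))).

(* The w i are constant vector fields on V, so no bracket terms occur; the
   exterior derivative of V commutes with restriction to M. *)
Definition extd (R : realType) (V : normedModType R) (k : nat)
    (alpha : dform V k) : dform V k.+1 := fun p w =>
  \sum_(i < k.+1) (-1) ^+ i *
     'D_(w i) (fun q => alpha q (fun j => w (lift i j)) : R^o) p.

Definition riemannian_metric (R : realType) (V : normedModType R) (M : set V)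
    (T : V -> set V) (g : V -> V -> V -> R) : Prop :=
  [/\ exists U : set V, [/\ open U, M `<=` U,
        forall p, U p -> forall (c : R) (u v w : V),
          g p (c *: u + v) w = c * g p u w + g p v w /\
          g p w (c *: u + v) = c * g p w u + g p w v
        & forall u v, smooth_on U (fun p => g p u v : R^o)],
      forall p u v, M p -> T p u -> T p v -> g p u v = g p v u
    & forall p u, M p -> T p u -> u != 0 -> 0 < g p u u].

Definition almost_complex (R : realType) (V : normedModType R) (M : set V)
    (T : V -> set V) (J : V -> V -> V) : Prop :=
  [/\ exists U : set V, [/\ open U, M `<=` U,
        forall p, U p -> forall (c : R) (u v : V),
          J p (c *: u + v) = c *: J p u + J p v
        & forall u, smooth_on U (fun p => J p u)],
      forall p u, M p -> T p u -> T p (J p u)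
    & forall p u, M p -> T p u -> J p (J p u) = - u].

Definition almost_hermitian (R : realType) (V : normedModType R) (M : set V)
    (T : V -> set V) (g : V -> V -> V -> R) (J : V -> V -> V) : Prop :=
  [/\ riemannian_metric M T g, almost_complex M T J
    & forall p u v, M p -> T p u -> T p v -> g p (J p u) (J p v) = g p u v].

Definition fundamental_form (R : realType) (V : normedModType R)
    (g : V -> V -> V -> R) (J : V -> V -> V) : dform V 2 :=
  fun p w => g p (J p (w 0)) (w 1).

(* psi + i psih is of type (3,0): its complex multilinear extension vanishes
   as soon as one argument is a (0,1)-vector u + i J u. *)
Definition type30 (R : realType) (V : normedModType R) (M : set V)
    (T : V -> set V) (J : V -> V -> V) (psi psih : dform V 3) : Prop :=
  let Psi p w : R[i] := Complex (psi p w) (psih p w) in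
  forall p (w : 'I_3 -> V), M p -> (forall i, T p (w i)) ->
    forall i, Psi p w + 'i%C * Psi p [eta w with i |-> J p (w i)] = 0.

Definition type11 (R : realType) (V : normedModType R) (M : set V)
    (T : V -> set V) (J : V -> V -> V) (sigma : dform V 2) : Prop :=
  form_eq M T (fun p w => sigma p (fun i => J p (w i))) sigma.

(* dim M = 6 is understood. *)
Definition SU3_structure (R : realType) (V : normedModType R) (M : set V)
    (T : V -> set V) (g : V -> V -> V -> R) (J : V -> V -> V)
    (omega : dform V 2) (psi psih : dform V 3) : Prop :=
  [/\ smooth_form M omega, smooth_form M psi & smooth_form M psih] /\
  [/\ almost_hermitian M T g J,
      form_eq M T omega (fundamental_form g J),
      type30 M T J psi psih
    & @form_eq R V M T 6 (wedge psi psih)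
        (fun p w => 2 / 3 * wedge omega (wedge omega omega) p w)].

Definition symplectic_half_flat (R : realType) (V : normedModType R)
    (M : set V) (T : V -> set V) (omega : dform V 2) (psi : dform V 3) : Prop :=
  form_eq M T (extd omega) (@form0 R V 3) /\
  form_eq M T (extd psi) (@form0 R V 4).

(* For a symplectic half-flat structure such a sigma exists and its restriction
   to M is unique. *)
Definition is_sigma (R : realType) (V : normedModType R) (M : set V)
    (T : V -> set V) (J : V -> V -> V) (omega : dform V 2) (psih : dform V 3)
    (sigma : dform V 2) : Prop :=
  [/\ smooth_form M sigma, type11 M T J sigma,
      form_eq M T (wedge sigma (wedge omega omega)) (@form0 R V 6)
    & @form_eq R V M T 4 (extd psih) (wedge sigma omega)].

Definition strict (R : realType) (V : normedModType R) (M : set V)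
    (T : V -> set V) (J : V -> V -> V) (omega : dform V 2) (psih : dform V 3)
    : Prop :=
  exists2 sigma : dform V 2, is_sigma M T J omega psih sigma
    & ~ form_eq M T sigma (@form0 R V 2).

(* A piecewise C^1 path is a list of C^1 curves parametrised by [0, 1], each
   starting where the previous one ends. *)
Definition C1_curve (R : realType) (V : normedModType R) (M : set V)
    (c : R -> V) : Prop :=
  [/\ forall t, derivable c t 1, continuous (derive1 c)
    & forall t, 0 <= t <= 1 -> M (c t)].

Fixpoint joins (R : realType) (V : normedModType R) (M : set V)
    (cs : seq (R -> V)) (p q : V) : Prop :=
  match cs with
  | [::] => p = q
  | c :: cs' => [/\ C1_curve M c, c 0 = p & joins M cs' (c 1) q]
  end.

Definition curve_length (R : realType) (V : normedModType R)
    (g : V -> V -> V -> R) (c : R -> V) : \bar R :=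
  (\int[@lebesgue_measure R]_(t in `[0%R, 1%R])
     (Num.sqrt (g (c t) (derive1 c t) (derive1 c t)))%:E)%E.

Definition path_length (R : realType) (V : normedModType R)
    (g : V -> V -> V -> R) (cs : seq (R -> V)) : \bar R :=
  (\sum_(c <- cs) curve_length g c)%E.

Definition riemannian_dist (R : realType) (V : normedModType R) (M : set V)
    (g : V -> V -> V -> R) (p q : V) : \bar R :=
  ereal_inf [set path_length g cs | cs in [set cs | joins M cs p q]].

Definition complete_metric (R : realType) (V : normedModType R) (M : set V)
    (g : V -> V -> V -> R) : Prop :=
  forall x : nat -> V, (forall n, M (x n)) ->
    (forall e : R, 0 < e -> exists N, forall m n, (N <= m)%N -> (N <= n)%N ->
       (riemannian_dist M g (x m) (x n) < e%:E)%E) ->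
    exists2 p, M p &
      forall e : R, 0 < e -> exists N, forall n, (N <= n)%N ->
       (riemannian_dist M g (x n) p < e%:E)%E.

(* The 4 x 2 matrix with columns x, v stands for the pair (x, v) in
   R^4 x R^4; TS3 is the set of pairs with x.x = 1 and x.v = 0. *)
Definition ip (R : realType) (x y : 'cV[R]_4) : R := \sum_i x i 0 * y i 0.

Definition TS3 (R : realType) : set 'M[R]_(4, 2) :=
  [set p | ip (col 0 p) (col 0 p) = 1 /\ ip (col 0 p) (col 1 p) = 0].

(* The kernel of the differential at p of the submersion
   (x, v) |-> (x.x, x.v) defining TS3. *)
Definition tTS3 (R : realType) (p : 'M[R]_(4, 2)) : set 'M[R]_(4, 2) :=
  [set w | 2 * ip (col 0 p) (col 0 w) = 0 /\
           ip (col 0 w) (col 1 p) + ip (col 0 p) (col 1 w) = 0].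

Definition SO4 (R : realType) : set 'M[R]_4 :=
  [set A | A^T *m A = 1%:M /\ \det A = 1].

(* A acts by (x, v) |-> (A x, A v), i.e. by the differential of x |-> A x; this
   map is linear, hence equal to its own differential. *)
Definition SO4_invariant (R : realType) (k : nat)
    (alpha : dform 'M[R]_(4, 2) k) : Prop :=
  forall A, SO4 A ->
    form_eq (@TS3 R) (@tTS3 R)
      (fun p w => alpha (A *m p) (fun i => A *m w i)) alpha.

(* Main.v *)
Require Import Defs.
From mathcomp Require Import all_boot all_order all_algebra all_fingroup.
From mathcomp Require Import all_classical all_reals all_analysis.
From mathcomp Require Import measurable_realfun.
From mathcomp Require Import ring lra complex.
Import Order.TTheory GRing.Theory Num.Theory.
Import numFieldNormedType.Exports.
Local Open Scope ring_scope.
Set Implicit Arguments.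
Unset Strict Implicit.
Unset Printing Implicit Defensive.

(** In the coordinates (x, v) of R^4 x R^4 put q := sqrt (1 + |v|^2),
    P := 1 + v v^T and, on T(TS3), eta := (dv)^perp - q dx, where perp is the
    projection orthogonal to x.  Then
      g = <P dx, dx> + <P^-1 eta, eta>,
      omega = sum dx_i /\ dv_i = sum dx_i /\ eta_i,
      psi + i psih = (i / q) vol (x, zeta, zeta, zeta) / 6, zeta := P dx + i eta,
    is an SU(3)-structure whose (1,0)-forms are the components of zeta.  The
    factor q in eta is the one for which d psi = 0, and then
    d psih = sigma /\ omega with
      sigma = (3 / q) (vol (x, v, dx, dx) + vol (x, v, eta, eta)) / 2 <> 0.
    All data are SO(4)-equivariant and polynomial in x, v, 1 / q, so each identity
    is checked at x = e_0, v = t e_1 as a polynomial identity.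
    Completeness: x_i, ln (1 + |v|^2) and v_i / (1 + |v|^2) are Lipschitz for g,
    so a Cauchy sequence converges in R^4 x R^4 to a point of TS3, and nearby
    points are joined by short curves. *)

(** * Determinants and wedge products *)

(** The form omega does not see the factor q in eta, since sum dx_i /\ dx_i = 0 and x.dx = 0; this
    leaves q free to be fixed by d psi = 0. On the orthogonal complement of x one has det P = 1 +
    |v|^2 = q^2, and the factor 1 / q = (det P)^(-1/2) in Psi is what the volume normalisation asks
    for. Two obstacles shape the computation. A wedge product is a sum over permutations, 720 of
    them in degree 6, which cannot be expanded term by term. At a point in normal form each form is
    therefore written as a list of coefficients and index lists; by Laplace expansion wedging
    becomes concatenation of index lists, and every form of degree 6 becomes a multiple of a single
    determinant. Moreover the slice x = e_0, v = t e_1 is not open, so derivatives cannot be taken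
    along it. They are computed at a general point, in terms of inner products and [vol], and only
    the resulting equivariant expressions are evaluated on the slice. *)

Definition o0 : 'I_4 := @Ordinal 4 0 isT.
Definition o1 : 'I_4 := @Ordinal 4 1 isT.
Definition o2 : 'I_4 := @Ordinal 4 2 isT.
Definition o3 : 'I_4 := @Ordinal 4 3 isT.

Lemma big_ord4 (T : nmodType) (F : 'I_4 -> T) :
  \sum_i F i = F o0 + F o1 + F o2 + F o3.
Proof.
rewrite !big_ord_recl big_ord0 addr0 !addrA.
by do 3?[congr (_ + _)]; congr F; apply: val_inj.
Qed.

Lemma ord4P (P : 'I_4 -> Prop) : P o0 -> P o1 -> P o2 -> P o3 -> forall i, P i.
Proof.
move=> h0 h1 h2 h3 [[|[|[|[|//]]]] hi].
- by rewrite (_ : Ordinal hi = o0) //; apply: val_inj.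
- by rewrite (_ : Ordinal hi = o1) //; apply: val_inj.
- by rewrite (_ : Ordinal hi = o2) //; apply: val_inj.
- by rewrite (_ : Ordinal hi = o3) //; apply: val_inj.
Qed.

(* Laplace expansion in a form that [vm_compute] can evaluate. *)
Fixpoint ldet (T : pzRingType) (n : nat) (f : nat -> nat -> T) : T :=
  if n is m.+1 then
    foldr (fun j r => (if odd j then - 1 else 1) * f 0 j
             * ldet m (fun i k => f i.+1 (bump j k)) + r) 0 (iota 0 n)
  else 1.

Lemma det_ldet (T : comPzRingType) n (f : nat -> nat -> T) :
  \det (\matrix_(i < n, j < n) f i j) = ldet n f.
Proof.
elim: n f => [|n IH] f; first by rewrite det_mx00.
rewrite (expand_det_row _ ord0).
transitivity (\sum_(0 <= j < n.+1) ((if odd j then - 1 else 1) * f 0 j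
             * ldet n (fun i k => f i.+1 (bump j k)))); last first.
  have E (F : nat -> T) s : \sum_(j <- s) F j = foldr (fun j r => F j + r) 0 s.
    by rewrite unlock.
  by rewrite E /index_iota subn0.
rewrite big_mkord; apply: eq_bigr => j _.
rewrite mxE /cofactor -IH add0n -signr_odd mulrA [_ * (-1) ^+ _]mulrC.
case: (odd j) => /=; rewrite ?expr1 ?expr0;
  congr (_ * _ * \det _); by apply/matrixP => i k; rewrite !mxE.
Qed.

Definition cols4 (R : realType) (a b c d : 'cV[R]_4) : 'M[R]_4 :=
  \matrix_(i, j) nth 0 [:: a; b; c; d] j i 0.

Definition vol (R : realType) (a b c d : 'cV[R]_4) : R := \det (cols4 a b c d).

Lemma mul_cols4 (R : realType) (A : 'M[R]_4) (a b c d : 'cV[R]_4) :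
  A *m cols4 a b c d = cols4 (A *m a) (A *m b) (A *m c) (A *m d).
Proof.
apply/matrixP => i j; rewrite !mxE.
by elim/ord4P: j => /=; rewrite mxE; apply: eq_bigr => k _; rewrite mxE.
Qed.

Definition det3 (R : realType) (a1 a2 a3 b1 b2 b3 c1 c2 c3 : R) : R :=
  a1 * (b2 * c3 - b3 * c2) - b1 * (a2 * c3 - a3 * c2) + c1 * (a2 * b3 - a3 * b2).

Lemma volE (R : realType) (a b c d : 'cV[R]_4) :
  let D i j k := det3 (b i 0) (b j 0) (b k 0) (c i 0) (c j 0) (c k 0)
                      (d i 0) (d j 0) (d k 0) in
  vol a b c d = a o0 0 * D o1 o2 o3 - a o1 0 * D o0 o2 o3
         + a o2 0 * D o0 o1 o3 - a o3 0 * D o0 o1 o2.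
Proof.
move=> D; rewrite /vol -det_tr.
pose f i j := nth 0 [:: a; b; c; d] i (inord j) 0.
rewrite (_ : _^T = \matrix_(i < 4, j < 4) f i j); last first.
  by apply/matrixP => i j; rewrite !mxE /f inord_val.
rewrite det_ldet /= /f /= /bump /= ?addn0 ?add0n.
have E k (h : (k < 4)%N) : inord k = Ordinal h :> 'I_4.
  by apply: val_inj; rewrite /= inordK.
rewrite /addn /= (E 0 isT) (E 1 isT) (E 2 isT) (E 3 isT) /D /det3.
rewrite -/o0 -/o1 -/o2 -/o3.
by ring.
Qed.

Lemma vol_mul (R : realType) (A : 'M[R]_4) (a b c d : 'cV[R]_4) :
  \det A = 1 -> vol (A *m a) (A *m b) (A *m c) (A *m d) = vol a b c d.
Proof. by move=> dA; rewrite /vol -mul_cols4 det_mulmx dA mul1r. Qed.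

Lemma ip_mul (R : realType) (A : 'M[R]_4) (a b : 'cV[R]_4) :
  A^T *m A = 1%:M -> ip (A *m a) (A *m b) = ip a b.
Proof.
move=> AA; have E (x y : 'cV[R]_4) : ip x y = (x^T *m y) 0 0.
  by rewrite mxE; apply: eq_bigr => i _; rewrite mxE.
by rewrite !E trmx_mul -mulmxA (mulmxA A^T) AA mul1mx.
Qed.

Lemma ipE (R : realType) (a b : 'cV[R]_4) :
  ip a b = a o0 0 * b o0 0 + a o1 0 * b o1 0 + a o2 0 * b o2 0 + a o3 0 * b o3 0.
Proof. by rewrite /ip big_ord4. Qed.

Lemma perm_sum_subproof k l (s : 'S_k) (t : 'S_l) :
  injective (fun x : 'I_(k + l) =>
    match fintype.split x with
    | inl i => lshift l (s i) | inr j => rshift k (t j)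
    end).
Proof.
move=> x y; rewrite -{2}(splitK x) -{2}(splitK y).
case: (fintype.split x) => i; case: (fintype.split y) => j /= e.
- by move/lshift_inj/perm_inj: e => ->.
- by move/eqP: e; rewrite eq_lrshift.
- by move/eqP: e; rewrite eq_rlshift.
- by move/rshift_inj/perm_inj: e => ->.
Qed.

Definition perm_sum k l (s : 'S_k) (t : 'S_l) : 'S_(k + l) :=
  perm (@perm_sum_subproof k l s t).

Lemma perm_suml k l (s : 'S_k) (t : 'S_l) i :
  perm_sum s t (lshift l i) = lshift l (s i).
Proof. by rewrite permE (unsplitK (inl i)). Qed.

Lemma perm_sumr k l (s : 'S_k) (t : 'S_l) j :
  perm_sum s t (rshift k j) = rshift k (t j).
Proof. by rewrite permE (unsplitK (inr j)). Qed.

(** Signs are determinants of permutation matrices, and the matrix of the block sum is block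
    diagonal. *)
Lemma sign_perm_sum (T : comNzRingType) k l (s : 'S_k) (t : 'S_l) :
  (-1) ^+ (perm_sum s t) = (-1) ^+ s * (-1) ^+ t :> T.
Proof.
rewrite -!(det_perm T) -(det_ublock _ 0); congr (\det _).
apply/matrixP => i j; rewrite -(splitK i) -(splitK j).
case: (fintype.split i) => {}i; case: (fintype.split j) => {}j /=.
- by rewrite block_mxEul !mxE perm_suml eq_lshift.
- by rewrite block_mxEur !mxE perm_suml eq_lrshift.
- by rewrite block_mxEdl !mxE perm_sumr eq_rlshift.
- by rewrite block_mxEdr !mxE perm_sumr eq_rshift.
Qed.

(** After Leibniz expansion of both minors, each pair (t, r) in S_k x S_l leaves a sum over s which
    the substitution [perm_sum t r * s] identifies with the full determinant. There are k! l! pairs,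
    which is the constant divided out in [wedge]. *)
Lemma laplace_det (T : comNzRingType) k l (F : 'M[T]_(k, k + l))
    (G : 'M[T]_(l, k + l)) :
  \sum_(s : 'S_(k + l)) (-1) ^+ s *
     (\det (colsub (fun i => s (lshift l i)) F) *
      \det (colsub (fun j => s (rshift k j)) G))
  = (k`! * l`!)%:R * \det (col_mx F G).
Proof.
transitivity (\sum_(s : 'S_(k + l)) \sum_(t : 'S_k) \sum_(r : 'S_l)
   (-1) ^+ (perm_sum t r * s)%g *
   \prod_i (col_mx F G) i ((perm_sum t r * s)%g i)).
  apply: eq_bigr => s _; rewrite /determinant mulr_suml mulr_sumr.
  apply: eq_bigr => t _; rewrite !mulr_sumr; apply: eq_bigr => r _.
  rewrite odd_permM signr_addb sign_perm_sum big_split_ord /=.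
  have -> : \prod_i col_mx F G (lshift l i) ((perm_sum t r * s)%g (lshift l i))
          = \prod_i (colsub (fun i => s (lshift l i)) F) i (t i).
    by apply: eq_bigr => i _; rewrite col_mxEu mxE permM perm_suml.
  have -> : \prod_i col_mx F G (rshift k i) ((perm_sum t r * s)%g (rshift k i))
          = \prod_i (colsub (fun i => s (rshift k i)) G) i (r i).
    by apply: eq_bigr => i _; rewrite col_mxEd mxE permM perm_sumr.
  move: ((-1) ^+ s) ((-1) ^+ t) ((-1) ^+ r) => x y z.
  by move: (\prod_i _) (\prod_i _) => a b; ring.
have H (t : 'S_k) (r : 'S_l) :
    \sum_(s : 'S_(k + l)) (-1) ^+ (perm_sum t r * s)%g *
       \prod_i (col_mx F G) i ((perm_sum t r * s)%g i) = \det (col_mx F G).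
  by rewrite /determinant [RHS](reindex_inj (mulgI (perm_sum t r))).
rewrite exchange_big /=.
transitivity (\sum_(t : 'S_k) \sum_(r : 'S_l) \det (col_mx F G)).
  by apply: eq_bigr => t _; rewrite exchange_big; apply: eq_bigr => r _; exact: H.
by rewrite !sumr_const !card_Sn -mulrnA mulr_natl mulnC.
Qed.

(* [X] lists the coordinate 1-forms; a term (c, I) stands for c times the
   wedge product of the coordinate forms with indices in I. *)
Definition form_of (R : realType) (V : normedModType R) (X : nat -> V -> R)
    (L : seq (R * seq nat)) (k : nat) (w : 'I_k -> V) : R :=
  \sum_(r <- L) r.1 * \det (\matrix_(i < k, j < k) X (nth 0 r.2 i) (w j)).

Definition mul_terms (R : realType) (L L' : seq (R * seq nat)) :=
  [seq (r.1 * r'.1, r.2 ++ r'.2) | r <- L, r' <- L'].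

(** By [laplace_det] the sum over permutations collapses to one determinant per pair of terms. The
    set T confines the hypotheses to tangent vectors, since the term lists used below represent the
    forms only there. *)
Lemma wedge_form_of (R : realType) (V : normedModType R) (X : nat -> V -> R)
    (T : set V) k l (alpha : dform V k) (beta : dform V l)
    (L L' : seq (R * seq nat)) p :
  all (fun r => size r.2 == k) L ->
  (forall w, (forall i, T (w i)) -> alpha p w = form_of X L w) ->
  (forall w, (forall i, T (w i)) -> beta p w = form_of X L' w) ->
  forall w, (forall i, T (w i)) ->
    wedge alpha beta p w = form_of X (mul_terms L L') w.
Proof.
move=> sL ha hb w hw; rewrite /wedge.
apply: (mulfI (x := (k`! * l`!)%:R)).
  by rewrite pnatr_eq0 muln_eq0 negb_or -!lt0n !fact_gt0.
rewrite mulrA divff ?mul1r; last first.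
  by rewrite pnatr_eq0 muln_eq0 negb_or -!lt0n !fact_gt0.
under eq_bigr => s _.
  rewrite ha ?hb /form_of; [|by move=> i; exact: hw..].
  rewrite big_distrlr mulr_sumr /=.
  under eq_bigr do rewrite mulr_sumr.
  over.
rewrite exchange_big /= /form_of /mul_terms big_allpairs_dep mulr_sumr big_seq_cond.
rewrite [RHS]big_seq_cond; apply: eq_bigr => r /andP[rL _].
have {}sL : size r.2 = k by apply/eqP; exact: (allP sL).
rewrite exchange_big mulr_sumr; apply: eq_bigr => r' _ /=.
pose F : 'M[R]_(k, k + l) := \matrix_(i, j) X (nth 0 r.2 i) (w j).
pose G : 'M[R]_(l, k + l) := \matrix_(i, j) X (nth 0 r'.2 i) (w j).
have -> : \matrix_(i < k + l, j < k + l) X (nth 0 (r.2 ++ r'.2) i) (w j)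
          = col_mx F G.
  apply/matrixP => i j; rewrite -(splitK i) mxE nth_cat sL.
  case: (fintype.split i) => {}i /=.
    by rewrite ltn_ord col_mxEu mxE.
  by rewrite ltnNge leq_addr /= addKn col_mxEd mxE.
rewrite mulrCA -laplace_det mulr_sumr; apply: eq_bigr => s _.
set a := (X in _ * (_ * X * _)); set b := (X in _ * (_ * _ * (_ * X))).
have -> : a = \det (colsub (fun i => s (lshift l i)) F).
  by congr (\det _); apply/matrixP => i j; rewrite !mxE.
have -> : b = \det (colsub (fun i => s (rshift k i)) G).
  by congr (\det _); apply/matrixP => i j; rewrite !mxE.
by move: ((-1) ^+ s) (\det _) (\det _) => e x y; ring.
Qed.

(** For indices below n this is 0 if an index repeats and the sign of the permutation otherwise. It
    is an integer so that [vm_compute] can evaluate it. *)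
Definition rows_sign n (I : seq nat) : int :=
  ldet n (fun i j => if nth 0 I i == j then 1 else 0).

(** Selecting rows is left multiplication by the 0-1 matrix whose determinant is [rows_sign]. *)
Lemma det_rows (R : realType) n (Y : nat -> 'I_n -> R) (I : seq nat) :
  (forall i, (i < n)%N -> (nth 0 I i < n)%N) ->
  \det (\matrix_(i < n, j < n) Y (nth 0 I i) j)
  = (rows_sign n I)%:~R * \det (\matrix_(i < n, j < n) Y i j).
Proof.
move=> hI.
rewrite /rows_sign -det_ldet -(det_map_mx (intmul 1)) -det_mulmx.
congr (\det _); apply/matrixP => i j; rewrite !mxE.
have h := hI i (ltn_ord i).
rewrite (bigD1 (Ordinal h)) //= big1 ?addr0 => [|m /negP hm].
  by rewrite !mxE eqxx mul1r.
rewrite !mxE; case: eqP => [e|_]; last by rewrite mul0r.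
by case: hm; apply/eqP/val_inj; rewrite /= e.
Qed.

(** * Functions polynomial in the entries and in 1 / q *)

(** Differentiability is kept beside the directional derivatives: the chain rule needs it, while
    [extd] and [Cn_on] only see ['D_v]. *)
Definition has_derive (R : realType) (f : 'M[R]_(4, 2) -> R)
    (df : 'M[R]_(4, 2) -> 'M[R]_(4, 2) -> R) :=
  forall p, differentiable f p /\ forall v, 'D_v f p = df p v.

Lemma has_derive_cst (R : realType) (c : R) : has_derive (fun=> c) (fun _ _ => 0).
Proof.
move=> p; split; first exact: differentiable_cst.
by move=> v; exact: derive_cst.
Qed.

Lemma has_derive_coord (R : realType) i j :
  has_derive (fun p : 'M[R]_(4, 2) => p i j) (fun _ v => v i j).
Proof.
move=> p; split; first exact: differentiable_coord.
move=> v.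
have H : derivable (id : 'M[R]_(4, 2) -> 'M[R]_(4, 2)) p v by exact: derivable_id.
have := congr1 (fun M : 'M[R]_(4, 2) => M i j) (derive_mx H).
by rewrite derive_id mxE.
Qed.

Lemma has_derive_add (R : realType) (f g : 'M[R]_(4, 2) -> R) df dg :
  has_derive f df -> has_derive g dg ->
  has_derive (fun p => f p + g p) (fun p v => df p v + dg p v).
Proof.
move=> hf hg p; have [f1 f2] := hf p; have [g1 g2] := hg p.
split; first exact: differentiableD.
move=> v; rewrite -f2 -g2; apply: (@deriveD _ _ _ f g); exact: diff_derivable.
Qed.

Lemma has_derive_mul (R : realType) (f g : 'M[R]_(4, 2) -> R) df dg :
  has_derive f df -> has_derive g dg ->
  has_derive (fun p => f p * g p) (fun p v => f p * dg p v + g p * df p v).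
Proof.
move=> hf hg p; have [f1 f2] := hf p; have [g1 g2] := hg p.
split; first exact: differentiableM.
move=> v; rewrite -f2 -g2; apply: (@deriveM _ _ f g); exact: diff_derivable.
Qed.

Lemma has_derive_ext (R : realType) (f g : 'M[R]_(4, 2) -> R) df dg :
  has_derive f df -> (forall p, f p = g p) -> (forall p v, df p v = dg p v) ->
  has_derive g dg.
Proof.
move=> hf /funext <- h p; have [f1 f2] := hf p; split => // v.
by rewrite f2 h.
Qed.

Lemma has_derive_comp (R : realType) (f : 'M[R]_(4, 2) -> R) df (g g' : R -> R) :
  has_derive f df -> (forall p, is_derive (f p) 1 g (g' (f p))) ->
  has_derive (fun p => g (f p)) (fun p v => g' (f p) * df p v).
Proof.
move=> hf hg p; have [f1 f2] := hf p.
have [/derivable1_diffP g1 g2] := hg p.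
have gf : differentiable (fun p => g (f p)) p.
  exact: (@differentiable_comp _ _ _ _ f g).
split => // v; rewrite deriveE // (@diff_comp _ _ _ _ f g) //=.
by rewrite diff1E // derive1E g2 -deriveE // f2 mulrC.
Qed.

Lemma has_derive_sum (R : realType) (I : Type) (s : seq I) (f : I -> 'M[R]_(4, 2) -> R) df :
  (forall i, has_derive (f i) (df i)) ->
  has_derive (fun p => \sum_(i <- s) f i p) (fun p v => \sum_(i <- s) df i p v).
Proof.
move=> h; elim: s => [|i s IH].
  by apply: has_derive_ext (has_derive_cst 0) _ _ => *; rewrite big_nil.
by apply: has_derive_ext (has_derive_add (h i) IH) _ _ => *; rewrite big_cons.
Qed.

Lemma has_derive_scale (R : realType) (c : R) (f : 'M[R]_(4, 2) -> R) df :
  has_derive f df -> has_derive (fun p => c * f p) (fun p v => c * df p v).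
Proof.
move=> h; apply: has_derive_ext (has_derive_mul (has_derive_cst c) h) _ _ => //= *.
by rewrite mulr0 addr0.
Qed.

Lemma has_derive_opp (R : realType) (f : 'M[R]_(4, 2) -> R) df :
  has_derive f df -> has_derive (fun p => - f p) (fun p v => - df p v).
Proof.
by move=> h; apply: has_derive_ext (has_derive_scale (-1) h) _ _ => *; rewrite mulN1r.
Qed.

Definition lin_fun (R : realType) (V : lmodType R) (f : V -> R) :=
  forall c u v, f (c *: u + v) = c * f u + f v.

Lemma lin_funE (R : realType) (f : 'M[R]_(4, 2) -> R) : lin_fun f ->
  forall p, f p = \sum_i \sum_j p i j * f (delta_mx i j).
Proof.
move=> hf p; rewrite [in LHS](matrix_sum_delta p).
have f0 : f 0 = 0.
  by apply: (addrI (f 0)); have := hf 1 0 0; rewrite scale1r mul1r !addr0.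
have fD (I : finType) (F : I -> 'M[R]_(4, 2)) : f (\sum_i F i) = \sum_i f (F i).
  by apply: (big_morph f) => // x y; have := hf 1 x y; rewrite scale1r mul1r.
rewrite fD; apply: eq_bigr => i _; rewrite fD; apply: eq_bigr => j _.
by rewrite -[_ *: _]addr0 hf f0 addr0.
Qed.

Lemma has_derive_lin (R : realType) (f : 'M[R]_(4, 2) -> R) :
  lin_fun f -> has_derive f (fun _ v => f v).
Proof.
move=> hf.
pose F i j (p : 'M[R]_(4, 2)) := p i j * f (delta_mx i j).
have : has_derive (fun p => \sum_i \sum_j F i j p) (fun p v => \sum_i \sum_j F i j v).
  apply: has_derive_sum => i; apply: has_derive_sum => j.
  apply: has_derive_ext (has_derive_scale (f (delta_mx i j)) (has_derive_coord i j)) _ _ => *;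
    exact: mulrC.
by move=> h; apply: has_derive_ext h _ _ => *; rewrite [RHS]lin_funE.
Qed.

Lemma has_derive_bilin (R : realType) (B : 'M[R]_(4, 2) -> 'M[R]_(4, 2) -> R) :
  (forall q, lin_fun (B^~ q)) -> (forall p, lin_fun (B p)) ->
  has_derive (fun p => B p p) (fun p v => B v p + B p v).
Proof.
move=> h1 h2.
pose F i j (p : 'M[R]_(4, 2)) := p i j * B (delta_mx i j) p.
pose dF i j (p v : 'M[R]_(4, 2)) :=
  p i j * B (delta_mx i j) v + B (delta_mx i j) p * v i j.
have : has_derive (fun p => \sum_i \sum_j F i j p) (fun p v => \sum_i \sum_j dF i j p v).
  apply: has_derive_sum => i; apply: has_derive_sum => j.
  exact: has_derive_mul (has_derive_coord i j) (has_derive_lin (h2 _)).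
move=> h; apply: has_derive_ext h _ _ => [p|p v]; first by rewrite [RHS](lin_funE (h1 p)).
have /= E1 := lin_funE (h1 p) v; have /= E2 := lin_funE (h1 v) p.
rewrite /= E1 E2. rewrite -[RHS]big_split /=. apply: eq_bigr => i _.
rewrite -[RHS]big_split; apply: eq_bigr => j _ /=.
by rewrite /dF; ring.
Qed.

(* Closed under directional derivatives as soon as it contains those of the
   generator s; this gives smoothness without computing higher derivatives. *)
Inductive polyfun (R : realType) (s : 'M[R]_(4, 2) -> R) :
    ('M[R]_(4, 2) -> R) -> Prop :=
| polyfun_cst c : polyfun s (fun=> c)
| polyfun_coord i j : polyfun s (fun p => p i j)
| polyfun_gen : polyfun s s
| polyfun_add f g : polyfun s f -> polyfun s g -> polyfun s (fun p => f p + g p)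
| polyfun_mul f g : polyfun s f -> polyfun s g -> polyfun s (fun p => f p * g p).

Lemma polyfun_derive (R : realType) (s : 'M[R]_(4, 2) -> R) ds :
  has_derive s ds -> (forall v, polyfun s (fun p => ds p v)) ->
  forall f, polyfun s f ->
    exists2 df, has_derive f df & forall v, polyfun s (fun p => df p v).
Proof.
move=> hs ns f; elim=> {f} [c|i j||f g hf [df Df nf] hg [dg Dg ng]
  |f g hf [df Df nf] hg [dg Dg ng]].
- by eexists; [exact: has_derive_cst|move=> v; exact: polyfun_cst].
- by eexists; [exact: has_derive_coord|move=> v; exact: polyfun_cst].
- by exists ds.
- by eexists; [exact: has_derive_add Df Dg|move=> v; exact: polyfun_add].
- eexists; [exact: has_derive_mul Df Dg|move=> v].
  by apply: polyfun_add; exact: polyfun_mul.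
Qed.

Lemma polyfun_Cn (R : realType) (s : 'M[R]_(4, 2) -> R) ds :
  has_derive s ds -> (forall v, polyfun s (fun p => ds p v)) ->
  forall n f, polyfun s f -> Cn_on setT n (f : 'M[R]_(4, 2) -> R^o).
Proof.
move=> hs ns; elim=> [|n IH] f /(polyfun_derive hs ns)[df Df ndf].
  split=> // p _; exact/differentiable_continuous/(Df p).1.
split; first by move=> p _; exact/differentiable_continuous/(Df p).1.
move=> v; split; first by move=> p _; exact/diff_derivable/(Df p).1.
rewrite (_ : (fun p => _) = fun p => df p v); first exact: IH.
by apply/funext => p; exact: (Df p).2.
Qed.

Lemma polyfun_mx_continuous (R : realType) (s : 'M[R]_(4, 2) -> R) ds :
  has_derive s ds -> (forall v, polyfun s (fun p => ds p v)) ->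
  forall F : 'M[R]_(4, 2) -> 'M[R]_(4, 2),
  (forall i j, polyfun s (fun p => F p i j)) -> continuous F.
Proof.
move=> hs ns F nF p; apply: differentiable_continuous.
rewrite (_ : F = \sum_i \sum_j (fun p => F p i j *: delta_mx i j)).
  apply: differentiable_sum => i; apply: differentiable_sum => j.
  have [df Df _] := polyfun_derive hs ns (nF i j).
  exact/differentiableZl/(Df p).1.
apply/funext => q; rewrite fct_sumE [LHS]matrix_sum_delta.
by apply: eq_bigr => i _; rewrite fct_sumE.
Qed.

Lemma polyfun_smooth_mx (R : realType) (s : 'M[R]_(4, 2) -> R) ds :
  has_derive s ds -> (forall v, polyfun s (fun p => ds p v)) ->
  forall F : 'M[R]_(4, 2) -> 'M[R]_(4, 2),
  (forall i j, polyfun s (fun p => F p i j)) -> smooth_on setT F.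
Proof.
move=> hs ns F nF n; elim: n F nF => [|n IH] F nF.
  by split=> // p _; apply: (polyfun_mx_continuous hs ns nF).
split; first by move=> p _; apply: (polyfun_mx_continuous hs ns nF).
have dF v p : derivable F p v.
  apply/derivable_mxP => i j.
  have [df Df _] := polyfun_derive hs ns (nF i j).
  exact/diff_derivable/(Df p).1.
move=> v; split; first by move=> p _; exact: dF.
apply: IH => i j; have [df Df ndf] := polyfun_derive hs ns (nF i j).
rewrite (_ : (fun p => _) = fun p => df p v); first exact: ndf.
by apply/funext => p; rewrite derive_mx // mxE; exact: (Df p).2.
Qed.

Notation pos p := (col (0 : 'I_2) p).
Notation vel p := (col (1 : 'I_2) p).

Lemma posD (R : realType) (c : R) (u v : 'M[R]_(4, 2)) :
  pos (c *: u + v) = c *: pos u + pos v.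
Proof. by rewrite linearP. Qed.

Lemma velD (R : realType) (c : R) (u v : 'M[R]_(4, 2)) :
  vel (c *: u + v) = c *: vel u + vel v.
Proof. by rewrite linearP. Qed.

Lemma ip_linl (R : realType) (b : 'cV[R]_4) : lin_fun (fun a => ip a b).
Proof. by move=> k u v; rewrite !ipE !mxE; ring. Qed.
Lemma ip_linr (R : realType) (a : 'cV[R]_4) : lin_fun (fun b => ip a b).
Proof. by move=> k u v; rewrite !ipE !mxE; ring. Qed.
Lemma ipC (R : realType) (a b : 'cV[R]_4) : ip a b = ip b a.
Proof. by rewrite !ipE; ring. Qed.

Lemma vol_lin1 (R : realType) (b c d : 'cV[R]_4) : lin_fun (fun a => vol a b c d).
Proof. by move=> k u v; rewrite !volE /det3 !mxE; ring. Qed.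
Lemma vol_lin2 (R : realType) (a c d : 'cV[R]_4) : lin_fun (fun b => vol a b c d).
Proof. by move=> k u v; rewrite !volE /det3 !mxE; ring. Qed.
Lemma vol_lin3 (R : realType) (a b d : 'cV[R]_4) : lin_fun (fun c => vol a b c d).
Proof. by move=> k u v; rewrite !volE /det3 !mxE; ring. Qed.
Lemma vol_lin4 (R : realType) (a b c : 'cV[R]_4) : lin_fun (fun d => vol a b c d).
Proof. by move=> k u v; rewrite !volE /det3 !mxE; ring. Qed.

Definition usq (R : realType) (p : 'M[R]_(4, 2)) : R := ip (vel p) (vel p).
Definition qinv (R : realType) (p : 'M[R]_(4, 2)) : R := (Num.sqrt (1 + usq p))^-1.

Lemma ip_ge0 (R : realType) (a : 'cV[R]_4) : 0 <= ip a a.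
Proof. by rewrite /ip sumr_ge0 // => i _; exact: sqr_ge0. Qed.

Lemma usq1_gt0 (R : realType) (p : 'M[R]_(4, 2)) : 0 < 1 + usq p.
Proof. by rewrite ltr_pwDl // ip_ge0. Qed.

Lemma qinv_gt0 (R : realType) (p : 'M[R]_(4, 2)) : 0 < qinv p.
Proof. by rewrite invr_gt0 sqrtr_gt0 usq1_gt0. Qed.

Lemma qinv2 (R : realType) (p : 'M[R]_(4, 2)) : qinv p ^+ 2 * (1 + usq p) = 1.
Proof.
rewrite /qinv exprVn sqr_sqrtr; last exact/ltW/usq1_gt0.
by rewrite mulVf // gt_eqF // usq1_gt0.
Qed.

Lemma has_derive_ipl (R : realType) (b : 'cV[R]_4) :
  has_derive (fun p => ip (vel p) b) (fun _ v => ip (vel v) b).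
Proof. by apply: has_derive_lin => k u v; rewrite velD ip_linl. Qed.

Lemma has_derive_usq (R : realType) :
  has_derive (@usq R) (fun p v => 2 * ip (vel p) (vel v)).
Proof.
have := @has_derive_bilin R (fun p q => ip (vel p) (vel q)) _ _.
move=> h; apply: has_derive_ext (h _ _) _ _ => // [q k u v|q k u v|p v].
- by rewrite velD ip_linl.
- by rewrite velD ip_linr.
- by rewrite ipC; ring.
Qed.

(** The derivative is again polynomial in 1 / q and the entries, which is the condition that
    [polyfun_derive] puts on its generator. *)
Lemma has_derive_qinv (R : realType) :
  has_derive (@qinv R) (fun p v => - qinv p ^+ 3 * ip (vel p) (vel v)).
Proof.
pose g (x : R) := (Num.sqrt x)^-1.
pose g' (x : R) := - (g x) ^+ 3 / 2.
have h := @has_derive_comp R (fun p => 1 + usq p) _ g g'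
  (has_derive_add (has_derive_cst 1) (@has_derive_usq R)) _.
apply: has_derive_ext (h _) _ _ => // [p|p v].
  have p0 := usq1_gt0 p; have q0 : Num.sqrt (1 + usq p) != 0.
    by rewrite gt_eqF // sqrtr_gt0.
  have [d1 d2] := is_derive1_sqrt p0.
  apply: DeriveDef; first exact: derivableV q0 d1.
  rewrite /g (deriveV q0 d1) d2 /g' /g /GRing.scale /=.
  by field.
by rewrite /g' -[g _]/(qinv p) add0r; field.
Qed.

Lemma has_derive_vol1 (R : realType) (b c d : 'cV[R]_4) :
  has_derive (fun p => vol (pos p) b c d) (fun _ v => vol (pos v) b c d).
Proof. by apply: has_derive_lin => k u v; rewrite posD vol_lin1. Qed.

Lemma has_derive_vol2 (R : realType) (c d : 'cV[R]_4) :
  has_derive (fun p => vol (pos p) (vel p) c d)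
      (fun p v => vol (pos v) (vel p) c d + vol (pos p) (vel v) c d).
Proof.
apply: (@has_derive_bilin R (fun p q => vol (pos p) (vel q) c d)) => q k u v.
- by rewrite posD vol_lin1.
- by rewrite velD vol_lin2.
Qed.

Section PolyfunRules.
Variable R : realType.
Implicit Types (f g : 'M[R]_(4, 2) -> R) (F G : 'M[R]_(4, 2) -> 'cV[R]_4).

Definition qpoly f := polyfun (@qinv R) f.

Lemma qpoly_ext f g : qpoly f -> (forall p, f p = g p) -> qpoly g.
Proof. by move=> h /funext <-. Qed.

Lemma qpoly_opp f : qpoly f -> qpoly (fun p => - f p).
Proof.
move=> h; apply: qpoly_ext (polyfun_mul (polyfun_cst _ (-1)) h) _ => p.
by rewrite mulN1r.
Qed.

Lemma qpoly_sub f g : qpoly f -> qpoly g -> qpoly (fun p => f p - g p).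
Proof. by move=> hf hg; apply: polyfun_add => //; exact: qpoly_opp. Qed.

Lemma qpoly_exp f n : qpoly f -> qpoly (fun p => f p ^+ n).
Proof.
move=> h; elim: n => [|n IH]; first exact: polyfun_cst.
by apply: qpoly_ext (polyfun_mul h IH) _ => p; rewrite exprS.
Qed.

Definition qpolyv F := forall i, qpoly (fun p => F p i 0).

Lemma qpolyv_cst a : qpolyv (fun=> a).
Proof. by move=> i; exact: polyfun_cst. Qed.

Lemma qpolyv_col j : qpolyv (fun p => col j p).
Proof. by move=> i; apply: qpoly_ext (polyfun_coord _ i j) _ => p; rewrite mxE. Qed.

Lemma qpolyv_add F G : qpolyv F -> qpolyv G -> qpolyv (fun p => F p + G p).
Proof.
by move=> hF hG i; apply: qpoly_ext (polyfun_add (hF i) (hG i)) _ => p; rewrite mxE.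
Qed.

Lemma qpolyv_scale f F : qpoly f -> qpolyv F -> qpolyv (fun p => f p *: F p).
Proof.
by move=> hf hF i; apply: qpoly_ext (polyfun_mul hf (hF i)) _ => p; rewrite mxE.
Qed.

Lemma qpolyv_opp F : qpolyv F -> qpolyv (fun p => - F p).
Proof.
by move=> hF i; apply: qpoly_ext (qpoly_opp (hF i)) _ => p; rewrite mxE.
Qed.

Lemma qpoly_ip F G : qpolyv F -> qpolyv G -> qpoly (fun p => ip (F p) (G p)).
Proof.
move=> hF hG; refine (qpoly_ext _ (fun p => esym (ipE _ _))).
by do ?apply: polyfun_add; apply: polyfun_mul; first [exact: hF | exact: hG].
Qed.

Lemma qpoly_vol F G H K : qpolyv F -> qpolyv G -> qpolyv H -> qpolyv K ->
  qpoly (fun p => vol (F p) (G p) (H p) (K p)).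
Proof.
move=> hF hG hH hK; refine (qpoly_ext _ (fun p => esym (volE _ _ _ _))).
by rewrite /det3; do !(first [apply: hF | apply: hG | apply: hH | apply: hK
  | apply: qpoly_sub | apply: polyfun_add | apply: polyfun_mul]).
Qed.

Lemma qpoly_usq : qpoly (@usq R).
Proof. by apply: qpoly_ip; exact: qpolyv_col. Qed.

Lemma qpoly_dslo v : qpoly (fun p => - qinv p ^+ 3 * ip (vel p) (vel v)).
Proof.
apply: polyfun_mul; first exact/qpoly_opp/qpoly_exp/polyfun_gen.
by apply: qpoly_ip; [exact: qpolyv_col|exact: qpolyv_cst].
Qed.

Lemma qpoly_smooth f : qpoly f -> smooth_on setT (f : 'M[R]_(4, 2) -> R^o).
Proof. by move=> h n; exact: polyfun_Cn (@has_derive_qinv R) qpoly_dslo n f h. Qed.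

Lemma qpoly_smooth_mx (F : 'M[R]_(4, 2) -> 'M[R]_(4, 2)) :
  (forall i j, qpoly (fun p => F p i j)) -> smooth_on setT F.
Proof. exact: polyfun_smooth_mx (@has_derive_qinv R) qpoly_dslo F. Qed.

End PolyfunRules.

(** * The SU(3)-structure *)

Definition k0 : 'I_3 := @Ordinal 3 0 isT.
Definition k1 : 'I_3 := @Ordinal 3 1 isT.
Definition k2 : 'I_3 := @Ordinal 3 2 isT.

Lemma ord3P (P : 'I_3 -> Prop) : P k0 -> P k1 -> P k2 -> forall i, P i.
Proof.
move=> h0 h1 h2 [[|[|[|//]]] hi].
- by rewrite (_ : Ordinal hi = k0) //; apply: val_inj.
- by rewrite (_ : Ordinal hi = k1) //; apply: val_inj.
- by rewrite (_ : Ordinal hi = k2) //; apply: val_inj.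
Qed.

Lemma ord2P (P : 'I_2 -> Prop) : P 0 -> P 1 -> forall i, P i.
Proof.
move=> h0 h1 [[|[|//]] hi].
- by rewrite (_ : Ordinal hi = 0) //; apply: val_inj.
- by rewrite (_ : Ordinal hi = 1) //; apply: val_inj.
Qed.

Section Forms.
Variable R : realType.
Local Notation V := 'M[R]_(4, 2).
Implicit Types (p q : V) (w z : V).

Definition om2 w0 w1 : R := ip (pos w0) (vel w1) - ip (pos w1) (vel w0).

(* The letters a and b stand for dx and dv: v_aab is x contracted into vol, with
   dx in two slots and dv in the third, summed over the three positions; i_ab is
   the contraction with x and v. *)
Definition v_aaa p w0 w1 w2 := vol (pos p) (pos w0) (pos w1) (pos w2).
Definition v_bbb p w0 w1 w2 := vol (pos p) (vel w0) (vel w1) (vel w2).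
Definition v_aab p w0 w1 w2 := vol (pos p) (pos w0) (pos w1) (vel w2)
  + vol (pos p) (pos w0) (vel w1) (pos w2) + vol (pos p) (vel w0) (pos w1) (pos w2).
Definition v_abb p w0 w1 w2 := vol (pos p) (pos w0) (vel w1) (vel w2)
  + vol (pos p) (vel w0) (pos w1) (vel w2) + vol (pos p) (vel w0) (vel w1) (pos w2).
Definition i_aa p w0 w1 := vol (pos p) (vel p) (pos w0) (pos w1).
Definition i_bb p w0 w1 := vol (pos p) (vel p) (vel w0) (vel w1).
Definition i_ab p w0 w1 :=
  vol (pos p) (vel p) (pos w0) (vel w1) - vol (pos p) (vel p) (pos w1) (vel w0).

Definition wedge12 (f : V -> R) (h : V -> V -> R) w0 w1 w2 :=
  f w0 * h w1 w2 - f w1 * h w0 w2 + f w2 * h w0 w1.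

(* psi3, psih3 and sig2 are the formulas of the header expanded in dx and dv,
   using q^2 = 1 + |v|^2. *)
Definition psi3 p w0 w1 w2 : R :=
  (2 + usq p) * v_aaa p w0 w1 w2 - v_abb p w0 w1 w2
  + qinv p * (wedge12 (fun w => ip (vel p) (vel w)) (i_aa p) w0 w1 w2
             + v_bbb p w0 w1 w2).

Definition psih3 p w0 w1 w2 : R :=
  2 * v_aab p w0 w1 w2
  + wedge12 (fun w => ip (vel p) (pos w)) (i_ab p) w0 w1 w2
  - qinv p * ((1 + usq p) * (2 + usq p) * v_aaa p w0 w1 w2 + v_abb p w0 w1 w2
             + wedge12 (fun w => ip (vel p) (pos w)) (i_bb p) w0 w1 w2).

Definition sig2 p w0 w1 : R :=
  3 * qinv p * ((2 + usq p) * i_aa p w0 w1 + i_bb p w0 w1) - 3 * i_ab p w0 w1.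

Definition omega_form : dform V 2 := fun _ f => om2 (f 0) (f 1).
Definition psi_form : dform V 3 := fun p f => psi3 p (f k0) (f k1) (f k2).
Definition psih_form : dform V 3 := fun p f => psih3 p (f k0) (f k1) (f k2).
Definition sigma_form : dform V 2 := fun p f => sig2 p (f 0) (f 1).

(** This is q itself, written through [qinv] so as to stay polynomial in the entries and 1 / q. *)
Definition qf p := qinv p * (1 + usq p).

Definition eta p w : 'cV[R]_4 :=
  vel w - ip (pos p) (vel w) *: pos p - qf p *: pos w.

(* The last term vanishes on tangent vectors.  It makes the bounds below valid for
   all w, so that velocities of curves need not be shown to be tangent. *)
Definition gTS p w z : R :=
  ip (pos w) (pos z) + ip (vel p) (pos w) * ip (vel p) (pos z)
  + (ip (eta p w) (eta p z)
     - qinv p ^+ 2 * (ip (vel p) (eta p w) * ip (vel p) (eta p z)))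
  + (ip (pos p) (vel w) + ip (vel p) (pos w))
    * (ip (pos p) (vel z) + ip (vel p) (pos z)).

Definition mk2 (a b : 'cV[R]_4) : V := \matrix_(i, j) (if j == 0 then a else b) i 0.

(* dx (J w) = - P^-1 eta (w), with P^-1 = 1 - q^-2 v v^T. *)
Definition Jpos p w : 'cV[R]_4 :=
  (qinv p ^+ 2 * ip (vel p) (eta p w)) *: vel p - eta p w.
(* eta (J w) = P dx (w); the last term restores tangency. *)
Definition Jvel p w : 'cV[R]_4 :=
  qf p *: Jpos p w + pos w + ip (vel p) (pos w) *: vel p
  - ip (vel p) (Jpos p w) *: pos p.
Definition JTS p w : V := mk2 (Jpos p w) (Jvel p w).

Lemma pos_mk2 a b : pos (mk2 a b) = a.
Proof. by apply/colP => i; rewrite !mxE. Qed.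
Lemma vel_mk2 a b : vel (mk2 a b) = b.
Proof. by apply/colP => i; rewrite !mxE. Qed.

Lemma mx_ext p q : pos p = pos q -> vel p = vel q -> p = q.
Proof.
move=> e0 e1; apply/matrixP => i; elim/ord2P.
- by have := congr1 (fun c : 'cV[R]_4 => c i 0) e0; rewrite !mxE.
- by have := congr1 (fun c : 'cV[R]_4 => c i 0) e1; rewrite !mxE.
Qed.

Lemma pos_mul (A : 'M[R]_4) p : pos (A *m p) = A *m pos p.
Proof. by rewrite !colE mulmxA. Qed.
Lemma vel_mul (A : 'M[R]_4) p : vel (A *m p) = A *m vel p.
Proof. by rewrite !colE mulmxA. Qed.

Lemma vol_l2 a k u v c d :
  vol a (k *: u + v) c d = k * vol a u c d + vol a v c d :> R.
Proof. exact: vol_lin2. Qed.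
Lemma vol_l3 a k u v c d :
  vol a c (k *: u + v) d = k * vol a c u d + vol a c v d :> R.
Proof. exact: vol_lin3. Qed.
Lemma vol_l4 a k u v c d :
  vol a c d (k *: u + v) = k * vol a c d u + vol a c d v :> R.
Proof. exact: vol_lin4. Qed.
Lemma ip_l1 k u v a : ip (k *: u + v) a = k * ip u a + ip v a :> R.
Proof. exact: ip_linl. Qed.
Lemma ip_l2 k u v a : ip a (k *: u + v) = k * ip a u + ip a v :> R.
Proof. exact: ip_linr. Qed.

Lemma om2_multi p : multilinear (omega_form p) /\ Defs.alternating (omega_form p).
Proof.
split=> [i f c u v|f i j]; rewrite /omega_form /om2.
  by elim/ord2P: i => /=; rewrite !(posD, velD, ip_l1, ip_l2); ring.
by elim/ord2P: i; elim/ord2P: j => //= _ ->; ring.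
Qed.

Lemma sig2_multi p : multilinear (sigma_form p) /\ Defs.alternating (sigma_form p).
Proof.
split=> [i f c u v|f i j]; rewrite /sigma_form /sig2 /i_aa /i_bb /i_ab.
  by elim/ord2P: i => /=; rewrite !(posD, velD, vol_l3, vol_l4); ring.
by elim/ord2P: i; elim/ord2P: j => //= _ ->; rewrite !volE /det3; ring.
Qed.

Lemma psi3_multi p : multilinear (psi_form p) /\ Defs.alternating (psi_form p).
Proof.
split=> [i f c u v|f i j];
    rewrite /psi_form /psi3 /v_aaa /v_abb /v_bbb /wedge12 /i_aa.
  by elim/ord3P: i => /=;
    rewrite !(posD, velD, ip_l2, vol_l2, vol_l3, vol_l4); ring.
by elim/ord3P: i; elim/ord3P: j => //= _ ->; rewrite !volE /det3; ring.
Qed.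

Lemma psih3_multi p : multilinear (psih_form p) /\ Defs.alternating (psih_form p).
Proof.
split=> [i f c u v|f i j];
    rewrite /psih_form /psih3 /v_aaa /v_abb /v_aab /wedge12 /i_ab /i_bb.
  by elim/ord3P: i => /=;
    rewrite !(posD, velD, ip_l2, vol_l2, vol_l3, vol_l4); ring.
by elim/ord3P: i; elim/ord3P: j => //= _ ->; rewrite !volE /det3; ring.
Qed.

End Forms.

(** * Smoothness of the tensors and exterior derivatives at a general point *)

Section FormsCalculus.
Variable R : realType.
Local Notation V := 'M[R]_(4, 2).
Implicit Types (p q : V) (w z : V).

Ltac qpoly_tac := repeat first
  [ exact: polyfun_cst | exact: qpoly_usq | exact: polyfun_gen | exact: qpolyv_cst
  | exact: qpolyv_col | apply: qpoly_sub | apply: qpoly_opp | apply: qpoly_ip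
  | apply: qpoly_vol | apply: qpoly_exp | apply: polyfun_add | apply: polyfun_mul
  | apply: qpolyv_opp | apply: qpolyv_add | apply: qpolyv_scale ].

Lemma smooth_form_multi k (alpha : dform V k) :
  (forall p, multilinear (alpha p) /\ Defs.alternating (alpha p)) ->
  (forall f, qpoly (fun p => alpha p f)) -> smooth_form (@TS3 R) alpha.
Proof.
move=> ml sm; exists setT; split => //; first exact: openT.
by move=> w; exact/qpoly_smooth/sm.
Qed.

Lemma omega_smooth : smooth_form (@TS3 R) (@omega_form R).
Proof.
apply: smooth_form_multi => [|w]; first exact: om2_multi.
exact: polyfun_cst.
Qed.

Lemma sigma_smooth : smooth_form (@TS3 R) (@sigma_form R).
Proof.
apply: smooth_form_multi => [|f]; first exact: sig2_multi.
by rewrite /sigma_form /sig2 /i_aa /i_bb /i_ab; qpoly_tac.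
Qed.

Lemma psi_smooth : smooth_form (@TS3 R) (@psi_form R).
Proof.
apply: smooth_form_multi => [|f]; first exact: psi3_multi.
by rewrite /psi_form /psi3 /v_aaa /v_abb /v_bbb /wedge12 /i_aa; qpoly_tac.
Qed.

Lemma psih_smooth : smooth_form (@TS3 R) (@psih_form R).
Proof.
apply: smooth_form_multi => [|f]; first exact: psih3_multi.
by rewrite /psih_form /psih3 /v_aaa /v_abb /v_aab /wedge12 /i_ab /i_bb; qpoly_tac.
Qed.

Lemma qpolyv_eta w : qpolyv (fun p => eta p w).
Proof. by rewrite /eta /qf; qpoly_tac. Qed.

Lemma qpolyv_Jpos w : qpolyv (fun p => Jpos p w).
Proof. by rewrite /Jpos; qpoly_tac; exact: qpolyv_eta. Qed.

Lemma gTS_smooth w z : smooth_on setT (fun p => gTS p w z : R^o).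
Proof. by apply: qpoly_smooth; rewrite /gTS; qpoly_tac; exact: qpolyv_eta. Qed.

Lemma JTS_smooth w : smooth_on setT (fun p => JTS p w).
Proof.
apply: qpoly_smooth_mx => i j; rewrite /JTS /mk2.
apply: (@qpoly_ext _ (fun p => if j == 0 then Jpos p w i 0 else Jvel p w i 0)).
  case: (j == 0); first exact: qpolyv_Jpos.
  have : qpolyv (fun p => Jvel p w) by rewrite /Jvel /qf; qpoly_tac; exact: qpolyv_Jpos.
  exact.
by move=> p; rewrite mxE; case: ifP.
Qed.

Lemma eta_lin p c u v : eta p (c *: u + v) = c *: eta p u + eta p v.
Proof.
by rewrite /eta posD velD ip_l2; apply/colP => i; rewrite !mxE; ring.
Qed.

Lemma JTS_lin p c u v : JTS p (c *: u + v) = c *: JTS p u + JTS p v.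
Proof.
have Jp : Jpos p (c *: u + v) = c *: Jpos p u + Jpos p v.
  by rewrite /Jpos eta_lin ip_l2; apply/colP => i; rewrite !mxE; ring.
apply: mx_ext; first by rewrite [RHS]posD !pos_mk2.
rewrite [RHS]velD !vel_mk2 /Jvel Jp posD !ip_l2.
move: (Jpos p u) (Jpos p v) (pos u) (pos v) => a a' b b'.
by apply/colP => i; rewrite !mxE; ring.
Qed.

Lemma gTS_linl p c u v w : gTS p (c *: u + v) w = c * gTS p u w + gTS p v w.
Proof. by rewrite /gTS eta_lin !(posD, velD, ip_l1, ip_l2); ring. Qed.

Lemma gTS_sym p w z : gTS p w z = gTS p z w.
Proof. by rewrite /gTS (ipC (pos w)) (ipC (eta p w)); ring. Qed.

(** Derivatives at p in the direction q, by the Leibniz rule in the slots of x and v. The [v_] terms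
    are linear in p and serve as their own derivatives. *)
Definition di_aa p q w0 w1 := vol (pos q) (vel p) (pos w0) (pos w1)
  + vol (pos p) (vel q) (pos w0) (pos w1).
Definition di_bb p q w0 w1 := vol (pos q) (vel p) (vel w0) (vel w1)
  + vol (pos p) (vel q) (vel w0) (vel w1).
Definition di_ab p q w0 w1 :=
  (vol (pos q) (vel p) (pos w0) (vel w1) + vol (pos p) (vel q) (pos w0) (vel w1))
  - (vol (pos q) (vel p) (pos w1) (vel w0) + vol (pos p) (vel q) (pos w1) (vel w0)).

Lemma has_derive_i_aa w0 w1 :
  has_derive (fun p => i_aa p w0 w1) (fun p q => di_aa p q w0 w1).
Proof. exact: has_derive_vol2. Qed.
Lemma has_derive_i_bb w0 w1 :
  has_derive (fun p => i_bb p w0 w1) (fun p q => di_bb p q w0 w1).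
Proof. exact: has_derive_vol2. Qed.
Lemma has_derive_i_ab w0 w1 :
  has_derive (fun p => i_ab p w0 w1) (fun p q => di_ab p q w0 w1).
Proof. by apply: has_derive_add; [|apply: has_derive_opp]; exact: has_derive_vol2. Qed.

Lemma has_derive_aaa w0 w1 w2 :
  has_derive (fun p => v_aaa p w0 w1 w2) (fun _ q => v_aaa q w0 w1 w2).
Proof. exact: has_derive_vol1. Qed.
Lemma has_derive_bbb w0 w1 w2 :
  has_derive (fun p => v_bbb p w0 w1 w2) (fun _ q => v_bbb q w0 w1 w2).
Proof. exact: has_derive_vol1. Qed.
Lemma has_derive_aab w0 w1 w2 :
  has_derive (fun p => v_aab p w0 w1 w2) (fun _ q => v_aab q w0 w1 w2).
Proof. by do 2?[apply: has_derive_add]; exact: has_derive_vol1. Qed.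
Lemma has_derive_abb w0 w1 w2 :
  has_derive (fun p => v_abb p w0 w1 w2) (fun _ q => v_abb q w0 w1 w2).
Proof. by do 2?[apply: has_derive_add]; exact: has_derive_vol1. Qed.

Definition dwedge12 (f df : V -> R) (h dh : V -> V -> R) w0 w1 w2 :=
  wedge12 f dh w0 w1 w2 + wedge12 df h w0 w1 w2.

Lemma has_derive_wedge12 (f df : V -> V -> R) (h : V -> V -> V -> R) dh w0 w1 w2 :
  (forall w, has_derive (f^~ w) (fun _ q => df q w)) ->
  (forall w z, has_derive (fun p => h p w z) (fun p q => dh p q w z)) ->
  has_derive (fun p => wedge12 (f p) (h p) w0 w1 w2)
      (fun p q => dwedge12 (f p) (df q) (h p) (dh p q) w0 w1 w2).
Proof.
move=> hf hh.
have H w z y := has_derive_mul (hf w) (hh z y).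
have HH := has_derive_add (has_derive_add (H w0 w1 w2) (has_derive_opp (H w1 w0 w2))) (H w2 w0 w1).
by apply: has_derive_ext HH _ _ => //= p q; rewrite /dwedge12 /wedge12; ring.
Qed.

(** Derivative of [psi3] at p in the direction q, left in terms of [ip], [vol], [usq] and [qinv] so
    that it is visibly SO(4)-equivariant. *)
Definition dpsi3 p q w0 w1 w2 : R :=
  2 * ip (vel p) (vel q) * v_aaa p w0 w1 w2 + (2 + usq p) * v_aaa q w0 w1 w2
  - v_abb q w0 w1 w2
  + qinv p * (dwedge12 (fun w => ip (vel p) (vel w)) (fun w => ip (vel q) (vel w))
       (i_aa p) (di_aa p q) w0 w1 w2 + v_bbb q w0 w1 w2)
  - qinv p ^+ 3 * ip (vel p) (vel q)
    * (wedge12 (fun w => ip (vel p) (vel w)) (i_aa p) w0 w1 w2 + v_bbb p w0 w1 w2).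

Lemma has_derive_psi3 w0 w1 w2 :
  has_derive (fun p => psi3 p w0 w1 w2) (fun p q => dpsi3 p q w0 w1 w2).
Proof.
have H1 := has_derive_add (has_derive_cst (2 : R)) (@has_derive_usq R).
have H2 := has_derive_mul H1 (has_derive_aaa w0 w1 w2).
have H3 := has_derive_add (@has_derive_wedge12 (fun p w => ip (vel p) (vel w)) _ _ _ w0 w1 w2
  (fun w => has_derive_ipl (vel w)) has_derive_i_aa) (has_derive_bbb w0 w1 w2).
have H4 := has_derive_mul (@has_derive_qinv R) H3.
have H5 := has_derive_add (has_derive_add H2 (has_derive_opp (has_derive_abb w0 w1 w2))) H4.
by apply: has_derive_ext H5 _ _ => // p q; rewrite /dpsi3 /=; ring.
Qed.

Definition dpsih3 p q w0 w1 w2 : R :=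
  let c := ip (vel p) (vel q) in
  2 * v_aab q w0 w1 w2
  + dwedge12 (fun w => ip (vel p) (pos w)) (fun w => ip (vel q) (pos w))
       (i_ab p) (di_ab p q) w0 w1 w2
  - qinv p * ((1 + usq p) * (2 + usq p) * v_aaa q w0 w1 w2
             + (3 + 2 * usq p) * (2 * c) * v_aaa p w0 w1 w2 + v_abb q w0 w1 w2
             + dwedge12 (fun w => ip (vel p) (pos w)) (fun w => ip (vel q) (pos w))
                 (i_bb p) (di_bb p q) w0 w1 w2)
  + qinv p ^+ 3 * c
    * ((1 + usq p) * (2 + usq p) * v_aaa p w0 w1 w2 + v_abb p w0 w1 w2
             + wedge12 (fun w => ip (vel p) (pos w)) (i_bb p) w0 w1 w2).

Lemma has_derive_psih3 w0 w1 w2 :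
  has_derive (fun p => psih3 p w0 w1 w2) (fun p q => dpsih3 p q w0 w1 w2).
Proof.
have U := @has_derive_usq R.
have H1 := has_derive_mul (has_derive_add (has_derive_cst (1 : R)) U)
  (has_derive_add (has_derive_cst (2 : R)) U).
have H2 := has_derive_add (has_derive_mul H1 (has_derive_aaa w0 w1 w2)) (has_derive_abb w0 w1 w2).
have H3 := has_derive_add H2 (@has_derive_wedge12 (fun p w => ip (vel p) (pos w)) _ _ _ w0 w1 w2
  (fun w => has_derive_ipl (pos w)) has_derive_i_bb).
have H4 := has_derive_mul (@has_derive_qinv R) H3.
have H5 := has_derive_add (has_derive_scale 2 (has_derive_aab w0 w1 w2))
  (@has_derive_wedge12 (fun p w => ip (vel p) (pos w)) _ _ _ w0 w1 w2
  (fun w => has_derive_ipl (pos w)) has_derive_i_ab).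
have H6 := has_derive_add H5 (has_derive_opp H4).
by apply: has_derive_ext H6 _ _ => // p q; rewrite /dpsih3 /=; ring.
Qed.

Definition alt4 (F : V -> V -> V -> V -> R) w0 w1 w2 w3 :=
  F w0 w1 w2 w3 - F w1 w0 w2 w3 + F w2 w0 w1 w3 - F w3 w0 w1 w2.

Lemma extd3 (F : V -> V -> V -> V -> R) dF :
  (forall w0 w1 w2, has_derive (fun p => F p w0 w1 w2) (fun p q => dF p q w0 w1 w2)) ->
  forall p (f : 'I_4 -> V),
  extd (fun p (f : 'I_3 -> V) => F p (f k0) (f k1) (f k2)) p f
  = alt4 (dF p) (f o0) (f o1) (f o2) (f o3).
Proof.
move=> h p f; rewrite /extd big_ord4 /= !(h _ _ _ _).2 /alt4.
rewrite expr0 expr1 sqrrN expr1n exprS sqrrN expr1n mulr1 !mul1r !mulN1r.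
have E (i j : 'I_4) : val i = val j -> f i = f j by move/val_inj ->.
by do ![congr (_ + _) | congr (- _)]; congr (dF _ _ _ _ _); apply: E.
Qed.

(** The form is the restriction of the standard symplectic form of R^8, whose coefficients are
    constant. *)
Lemma extd_omega : form_eq (@TS3 R) (@tTS3 R) (extd (@omega_form R)) (@form0 R _ 3).
Proof.
move=> p f _ _; rewrite /extd /form0 big1 // => i _.
by rewrite derive_cst mulr0.
Qed.

End FormsCalculus.

(** * Reduction to x = e_0, v = t e_1 *)

Definition mx4 (R : realType) (f : nat -> nat -> R) : 'M[R]_4 := \matrix_(i, j) f i j.

Definition ent4 (R : realType) (l : seq (seq R)) i j : R := nth 0 (nth [::] l i) j.

Lemma mx4_SO4 (R : realType) (f : nat -> nat -> R) :
  (forall i j : 'I_4, f 0 i * f 0 j + f 1 i * f 1 j + f 2 i * f 2 j + f 3 i * f 3 j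
     = (i == j)%:R) -> ldet 4 f = 1 -> SO4 (mx4 f).
Proof.
move=> h d; split; last by rewrite /mx4 det_ldet.
by apply/matrixP => i j; rewrite !mxE big_ord4 !mxE /= h.
Qed.

Lemma SO4_mul (R : realType) (A B : 'M[R]_4) : SO4 A -> SO4 B -> SO4 (A *m B).
Proof.
move=> [a1 a2] [b1 b2]; split; last by rewrite det_mulmx a2 b2 mulr1.
by rewrite trmx_mul -mulmxA (mulmxA A^T) a1 mul1mx.
Qed.

Lemma mx4_mul (R : realType) (f : nat -> nat -> R) (a : 'cV[R]_4) (i : 'I_4) :
  (mx4 f *m a) i 0 = f i 0 * a o0 0 + f i 1 * a o1 0 + f i 2 * a o2 0 + f i 3 * a o3 0.
Proof. by rewrite !mxE big_ord4 !mxE. Qed.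

(** Left multiplication by the conjugate of the quaternion a + bi + cj + dk. For a unit quaternion
    it is a rotation taking that quaternion to 1 = e_0. *)
Definition quat_rows (R : realType) (a b c d : R) :=
  ent4 [:: [:: a; b; c; d]; [:: - b; a; d; - c]; [:: - c; - d; a; b];
           [:: - d; c; - b; a]].

Lemma quat_SO4 (R : realType) (a b c d : R) :
  a ^+ 2 + b ^+ 2 + c ^+ 2 + d ^+ 2 = 1 -> SO4 (mx4 (quat_rows a b c d)).
Proof.
move=> h; apply: mx4_SO4 => [i j|].
  by elim/ord4P: i; elim/ord4P: j; rewrite /quat_rows /ent4 /=;
    first [rewrite -[RHS]h | idtac]; ring.
rewrite /quat_rows /ent4 /=.
transitivity ((a ^+ 2 + b ^+ 2 + c ^+ 2 + d ^+ 2) ^+ 2); first by ring.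
by rewrite h expr1n.
Qed.

Definition rot12 (R : realType) (c s : R) :=
  ent4 [:: [:: 1; 0; 0; 0]; [:: 0; c; s; 0]; [:: 0; - s; c; 0]; [:: 0; 0; 0; 1]].
Definition rot23 (R : realType) (c s : R) :=
  ent4 [:: [:: 1; 0; 0; 0]; [:: 0; 1; 0; 0]; [:: 0; 0; c; s]; [:: 0; 0; - s; c]].

Lemma rot12_SO4 (R : realType) (c s : R) : c ^+ 2 + s ^+ 2 = 1 -> SO4 (mx4 (rot12 c s)).
Proof.
move=> h; apply: mx4_SO4 => [i j|]; last first.
  by rewrite /rot12 /ent4 /= -[RHS]h; ring.
by elim/ord4P: i; elim/ord4P: j; rewrite /rot12 /ent4 /=;
  first [ring | rewrite -[RHS]h; ring].
Qed.

Lemma rot23_SO4 (R : realType) (c s : R) : c ^+ 2 + s ^+ 2 = 1 -> SO4 (mx4 (rot23 c s)).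
Proof.
move=> h; apply: mx4_SO4 => [i j|]; last first.
  by rewrite /rot23 /ent4 /= -[RHS]h; ring.
by elim/ord4P: i; elim/ord4P: j; rewrite /rot23 /ent4 /=;
  first [ring | rewrite -[RHS]h; ring].
Qed.

Lemma givens (R : realType) (a b : R) :
  exists c s, c ^+ 2 + s ^+ 2 = 1 /\ - s * a + c * b = 0.
Proof.
have [e|ne] := eqVneq (a ^+ 2 + b ^+ 2) 0.
  exists 1, 0; split; first by ring.
  have : b ^+ 2 = 0.
    apply/eqP; rewrite eq_le sqr_ge0 andbT -e lerDr; exact: sqr_ge0.
  by move/eqP; rewrite sqrf_eq0 => /eqP ->; ring.
set r := Num.sqrt (a ^+ 2 + b ^+ 2).
have r2 : r ^+ 2 = a ^+ 2 + b ^+ 2 by rewrite sqr_sqrtr // addr_ge0 // sqr_ge0.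
have r0 : r != 0 by rewrite -sqrf_eq0 r2.
exists (a / r), (b / r); split; last by field.
by rewrite !expr_div_n -mulrDl r2 divff.
Qed.

Section NormalForm.
Variable R : realType.
Local Notation V := 'M[R]_(4, 2).

Record nform (t : R) (p : V) : Prop := NForm {
  nf_x0 : pos p o0 0 = 1; nf_x1 : pos p o1 0 = 0;
  nf_x2 : pos p o2 0 = 0; nf_x3 : pos p o3 0 = 0;
  nf_v0 : vel p o0 0 = 0; nf_v1 : vel p o1 0 = t;
  nf_v2 : vel p o2 0 = 0; nf_v3 : vel p o3 0 = 0 }.

Lemma TS3_SO4 (A : 'M[R]_4) p : SO4 A -> TS3 p -> TS3 (A *m p).
Proof. by move=> [AA _] [h1 h2]; split; rewrite pos_mul ?vel_mul ip_mul. Qed.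

Lemma tTS3_SO4 (A : 'M[R]_4) p w : SO4 A -> tTS3 p w -> tTS3 (A *m p) (A *m w).
Proof.
by move=> [AA _] [h1 h2]; split; rewrite !pos_mul ?vel_mul ?ip_mul.
Qed.

(** The quaternion rotation takes x to e_0; two plane rotations fixing e_0 then kill v_3 and v_2.
    The component v_0 vanishes because x.v = 0 is preserved. *)
Lemma nform_exists p : TS3 p -> exists A, SO4 A /\ exists t, nform t (A *m p).
Proof.
move=> pM; have [h1 _] := pM; move: h1; rewrite ipE => h1.
pose A1 := mx4 (quat_rows (pos p o0 0) (pos p o1 0) (pos p o2 0) (pos p o3 0)).
have S1 : SO4 A1 by apply: quat_SO4; rewrite -h1; ring.
pose p1 := A1 *m p.
have E0 : pos p1 o0 0 = 1.
  by rewrite pos_mul mx4_mul /quat_rows /ent4 /= -h1; ring.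
have E1 : pos p1 o1 0 = 0 by rewrite pos_mul mx4_mul /quat_rows /ent4 /=; ring.
have E2 : pos p1 o2 0 = 0 by rewrite pos_mul mx4_mul /quat_rows /ent4 /=; ring.
have E3 : pos p1 o3 0 = 0 by rewrite pos_mul mx4_mul /quat_rows /ent4 /=; ring.
have [c [s [cs e23]]] := givens (vel p1 o2 0) (vel p1 o3 0).
pose A2 := mx4 (rot23 c s); have S2 : SO4 A2 := rot23_SO4 cs.
pose p2 := A2 *m p1.
have [c' [s' [cs' e12]]] := givens (vel p2 o1 0) (vel p2 o2 0).
pose A3 := mx4 (rot12 c' s'); have S3 : SO4 A3 := rot12_SO4 cs'.
have F3 : vel p2 o3 0 = 0.
  by rewrite vel_mul mx4_mul /rot23 /ent4 /= -[RHS]e23; ring.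
have F0 : pos p2 o0 0 = 1.
  by rewrite pos_mul mx4_mul /rot23 /ent4 /= E0 E1 E2 E3; ring.
have F1 : pos p2 o1 0 = 0.
  by rewrite pos_mul mx4_mul /rot23 /ent4 /= E0 E1 E2 E3; ring.
have F2 : pos p2 o2 0 = 0.
  by rewrite pos_mul mx4_mul /rot23 /ent4 /= E0 E1 E2 E3; ring.
have F4 : pos p2 o3 0 = 0.
  by rewrite pos_mul mx4_mul /rot23 /ent4 /= E0 E1 E2 E3; ring.
have SA : SO4 (A3 *m (A2 *m A1)) by do !apply: SO4_mul.
exists (A3 *m (A2 *m A1)); split => //; exists (c' * vel p2 o1 0 + s' * vel p2 o2 0).
have -> : A3 *m (A2 *m A1) *m p = A3 *m p2 by rewrite /p2 /p1 !mulmxA.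
have G0 : pos (A3 *m p2) o0 0 = 1.
  by rewrite pos_mul mx4_mul /rot12 /ent4 /= F0 F1 F2 F4; ring.
have G1 : pos (A3 *m p2) o1 0 = 0.
  by rewrite pos_mul mx4_mul /rot12 /ent4 /= F0 F1 F2 F4; ring.
have G2 : pos (A3 *m p2) o2 0 = 0.
  by rewrite pos_mul mx4_mul /rot12 /ent4 /= F0 F1 F2 F4; ring.
have G3 : pos (A3 *m p2) o3 0 = 0.
  by rewrite pos_mul mx4_mul /rot12 /ent4 /= F0 F1 F2 F4; ring.
split => //.
- have [_] := TS3_SO4 S3 (TS3_SO4 S2 (TS3_SO4 S1 pM)).
  by rewrite -/p1 -/p2 ipE G0 G1 G2 G3 => <-; ring.
- by rewrite vel_mul mx4_mul /rot12 /ent4 /= F3; ring.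
- by rewrite vel_mul mx4_mul /rot12 /ent4 /= F3 -[RHS]e12; ring.
- by rewrite vel_mul mx4_mul /rot12 /ent4 /= F3; ring.
Qed.

(* Tangency at a point in normal form. *)
Definition ntan (t : R) (w : V) : Prop :=
  pos w o0 0 = 0 /\ vel w o0 0 = - t * pos w o1 0.

Lemma nform_tan t p w : nform t p -> tTS3 p w -> ntan t w.
Proof.
case=> x0 x1 x2 x3 v0 v1 v2 v3 [].
rewrite !ipE x0 x1 x2 x3 v0 v1 v2 v3 => h1 h2; split.
  by apply: (mulfI (x := 2)); rewrite ?pnatr_eq0 // mulr0 -[RHS]h1; ring.
by apply/eqP; rewrite -subr_eq0 -[X in _ == X]h2; apply/eqP; ring.
Qed.

(** The slice x = e_0, v = t e_1 meets every orbit, so an equivariant statement need only be checked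
    there. The index type is left open: ordinals serve for forms, [unit] and [bool] for statements
    about one or two vectors. *)
Lemma TS3_reduce (I : Type) (P : V -> (I -> V) -> Prop) :
  (forall (A : 'M[R]_4) p f, SO4 A -> P (A *m p) (fun i => A *m f i) -> P p f) ->
  (forall t p f, nform t p -> (forall i, ntan t (f i)) -> P p f) ->
  forall p f, TS3 p -> (forall i, tTS3 p (f i)) -> P p f.
Proof.
move=> hA hn p f pM fT; have [A [SA [t nf]]] := nform_exists pM.
apply: hA (SA) _; apply: hn (nf) _ => i; apply: nform_tan (nf) _.
exact: tTS3_SO4.
Qed.

End NormalForm.

(** * Pointwise identities *)

Lemma det_rows2 (R : realType) (V : Type) (X : nat -> V -> R) (f : 'I_2 -> V) a b :
  \det (\matrix_(i < 2, j < 2) X (nth 0 [:: a; b] i) (f j))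
  = X a (f 0) * X b (f 1) - X b (f 0) * X a (f 1).
Proof.
transitivity (ldet 2 (fun i j => X (nth 0 [:: a; b] i) (f (inord j)))).
  by rewrite -det_ldet; congr (\det _); apply/matrixP => i j; rewrite !mxE inord_val.
have E0 : inord 0 = 0 :> 'I_2 by apply: val_inj; rewrite /= inordK.
have E1 : inord 1 = 1 :> 'I_2 by apply: val_inj; rewrite /= inordK.
by rewrite /= /bump /= /addn /= E0 E1; ring.
Qed.

Lemma det_rows3 (R : realType) (V : Type) (X : nat -> V -> R) (f : 'I_3 -> V) a b c :
  \det (\matrix_(i < 3, j < 3) X (nth 0 [:: a; b; c] i) (f j))
  = det3 (X a (f k0)) (X b (f k0)) (X c (f k0)) (X a (f k1)) (X b (f k1)) (X c (f k1))
         (X a (f k2)) (X b (f k2)) (X c (f k2)).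
Proof.
transitivity (ldet 3 (fun i j => X (nth 0 [:: a; b; c] i) (f (inord j)))).
  by rewrite -det_ldet; congr (\det _); apply/matrixP => i j; rewrite !mxE inord_val.
have E k (h : (k < 3)%N) : inord k = Ordinal h :> 'I_3.
  by apply: val_inj; rewrite /= inordK.
rewrite /= /bump /= /addn /= (E 0 isT) (E 1 isT) (E 2 isT) -/k0 -/k1 -/k2 /det3.
by ring.
Qed.

Lemma det_rows4 (R : realType) (V : Type) (X : nat -> V -> R) (f : 'I_4 -> V) a b c d :
  let D x y z := det3 (X b x) (X c x) (X d x) (X b y) (X c y) (X d y)
                      (X b z) (X c z) (X d z) in
  \det (\matrix_(i < 4, j < 4) X (nth 0 [:: a; b; c; d] i) (f j))
  = X a (f o0) * D (f o1) (f o2) (f o3) - X a (f o1) * D (f o0) (f o2) (f o3)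
    + X a (f o2) * D (f o0) (f o1) (f o3) - X a (f o3) * D (f o0) (f o1) (f o2).
Proof.
move=> D.
transitivity (ldet 4 (fun i j => X (nth 0 [:: a; b; c; d] i) (f (inord j)))).
  by rewrite -det_ldet; congr (\det _); apply/matrixP => i j; rewrite !mxE inord_val.
have E k (h : (k < 4)%N) : inord k = Ordinal h :> 'I_4.
  by apply: val_inj; rewrite /= inordK.
rewrite /= /bump /= /addn /= (E 0 isT) (E 1 isT) (E 2 isT) (E 3 isT).
by rewrite -/o0 -/o1 -/o2 -/o3 /D /det3; ring.
Qed.

Ltac nf_entries nfp :=
  rewrite ?(nf_x0 nfp, nf_x1 nfp, nf_x2 nfp, nf_x3 nfp,
            nf_v0 nfp, nf_v1 nfp, nf_v2 nfp, nf_v3 nfp).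

Section Pointwise.
Variable R : realType.
Local Notation V := 'M[R]_(4, 2).
Implicit Types (p q : V) (w z : V) (t s : R).

(** Coordinates on the six-dimensional tangent space at a point in normal form; the remaining dx_0
    and dv_0 are determined there by [ntan]. *)
Definition fcoord (n : nat) w : R :=
  match n with
  | 0 => pos w o1 0 | 1 => pos w o2 0 | 2 => pos w o3 0
  | 3 => vel w o1 0 | 4 => vel w o2 0 | 5 => vel w o3 0
  | _ => 0
  end.

(* At a point in normal form; s is 1 / q, and the indices 0, 1, 2 and 3, 4, 5 stand
   for dx_1, dx_2, dx_3 and dv_1, dv_2, dv_3. *)
Definition omega_terms : seq (R * seq nat) :=
  [:: (1, [:: 0; 3]%N); (1, [:: 1; 4]%N); (1, [:: 2; 5]%N)].
Definition psi_terms t s : seq (R * seq nat) :=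
  [:: (2 + t ^+ 2, [:: 0; 1; 2]%N); (-1, [:: 0; 4; 5]%N); (-1, [:: 3; 1; 5]%N);
      (-1, [:: 3; 4; 2]%N); (s * t ^+ 2, [:: 3; 1; 2]%N); (s, [:: 3; 4; 5]%N)].
Definition psih_terms t s : seq (R * seq nat) :=
  [:: (- s * (1 + t ^+ 2) * (2 + t ^+ 2), [:: 0; 1; 2]%N);
      (- s * (1 + t ^+ 2), [:: 0; 4; 5]%N); (- s, [:: 3; 1; 5]%N);
      (- s, [:: 3; 4; 2]%N); (2, [:: 3; 1; 2]%N);
      (2 + t ^+ 2, [:: 0; 4; 2]%N); (2 + t ^+ 2, [:: 0; 1; 5]%N)].
Definition sigma_terms t s : seq (R * seq nat) :=
  [:: (3 * s * (2 + t ^+ 2) * t, [:: 1; 2]%N); (3 * s * t, [:: 4; 5]%N);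
      (- 3 * t, [:: 1; 5]%N); (- 3 * t, [:: 4; 2]%N)].

Lemma usq_nf t p : nform t p -> usq p = t ^+ 2.
Proof.
by case=> x0 x1 x2 x3 v0 v1 v2 v3; rewrite /usq ipE v0 v1 v2 v3; ring.
Qed.

Lemma omega_nf t p f : nform t p -> (forall i, ntan t (f i)) ->
  omega_form p f = form_of fcoord omega_terms f.
Proof.
move=> _ hf; rewrite /form_of /omega_terms !big_cons big_nil /= !det_rows2 /fcoord.
rewrite /omega_form /om2 !ipE.
by have [-> _] := hf 0; have [-> _] := hf 1; ring.
Qed.

Lemma sigma_nf t p f : nform t p -> (forall i, ntan t (f i)) ->
  sigma_form p f = form_of fcoord (sigma_terms t (qinv p)) f.
Proof.
move=> nfp hf; rewrite /form_of /sigma_terms !big_cons big_nil /= !det_rows2 /fcoord.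
rewrite /sigma_form /sig2 (usq_nf nfp) /i_aa /i_bb /i_ab !volE /det3.
by nf_entries nfp; ring.
Qed.

Lemma psi_nf t p f : nform t p -> (forall i, ntan t (f i)) ->
  psi_form p f = form_of fcoord (psi_terms t (qinv p)) f.
Proof.
move=> nfp hf; rewrite /form_of /psi_terms !big_cons big_nil /= !det_rows3 /fcoord.
rewrite /psi_form /psi3 (usq_nf nfp) /v_aaa /v_abb /v_bbb /wedge12 /i_aa.
by rewrite !volE !ipE /det3; nf_entries nfp; ring.
Qed.

Lemma psih_nf t p f : nform t p -> (forall i, ntan t (f i)) ->
  psih_form p f = form_of fcoord (psih_terms t (qinv p)) f.
Proof.
move=> nfp hf; rewrite /form_of /psih_terms !big_cons big_nil /= !det_rows3 /fcoord.
rewrite /psih_form /psih3 (usq_nf nfp) /v_aaa /v_abb /v_aab /wedge12 /i_ab /i_bb.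
by rewrite !volE !ipE /det3; nf_entries nfp; ring.
Qed.

End Pointwise.

(** * Invariance under SO(4), and the formulas for d psi and d psih *)

Section Global.
Variable R : realType.
Local Notation V := 'M[R]_(4, 2).
Implicit Types (p q : V) (w z : V) (t s : R).

Ltac inv_tac AA dA :=
  rewrite ?pos_mul ?vel_mul ?(vol_mul _ _ _ _ dA) ?(ip_mul _ _ AA).

Lemma usq_SO4 (A : 'M[R]_4) p : SO4 A -> usq (A *m p) = usq p.
Proof. by move=> [AA dA]; rewrite /usq vel_mul ip_mul. Qed.

Lemma qinv_SO4 (A : 'M[R]_4) p : SO4 A -> qinv (A *m p) = qinv p.
Proof. by move=> SA; rewrite /qinv usq_SO4. Qed.

Lemma omega_SO4 (A : 'M[R]_4) p f : SO4 A ->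
  omega_form (A *m p) (fun i => A *m f i) = omega_form p f.
Proof. by move=> [AA dA]; rewrite /omega_form /om2; inv_tac AA dA. Qed.

Lemma sigma_SO4 (A : 'M[R]_4) p f : SO4 A ->
  sigma_form (A *m p) (fun i => A *m f i) = sigma_form p f.
Proof.
move=> SA; have [AA dA] := SA.
rewrite /sigma_form /sig2 (usq_SO4 _ SA) (qinv_SO4 _ SA) /i_aa /i_bb /i_ab.
by inv_tac AA dA.
Qed.

Lemma psi_SO4 (A : 'M[R]_4) p f : SO4 A ->
  psi_form (A *m p) (fun i => A *m f i) = psi_form p f.
Proof.
move=> SA; have [AA dA] := SA.
rewrite /psi_form /psi3 (usq_SO4 _ SA) (qinv_SO4 _ SA).
by rewrite /v_aaa /v_abb /v_bbb /wedge12 /i_aa; inv_tac AA dA.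
Qed.

Lemma psih_SO4 (A : 'M[R]_4) p f : SO4 A ->
  psih_form (A *m p) (fun i => A *m f i) = psih_form p f.
Proof.
move=> SA; have [AA dA] := SA.
rewrite /psih_form /psih3 (usq_SO4 _ SA) (qinv_SO4 _ SA).
by rewrite /v_aaa /v_abb /v_aab /wedge12 /i_bb /i_ab; inv_tac AA dA.
Qed.

Lemma dpsi3_SO4 (A : 'M[R]_4) p q w0 w1 w2 : SO4 A ->
  dpsi3 (A *m p) (A *m q) (A *m w0) (A *m w1) (A *m w2) = dpsi3 p q w0 w1 w2.
Proof.
move=> SA; have [AA dA] := SA.
rewrite /dpsi3 (usq_SO4 _ SA) (qinv_SO4 _ SA).
by rewrite /v_aaa /v_abb /v_bbb /dwedge12 /wedge12 /i_aa /di_aa; inv_tac AA dA.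
Qed.

Lemma dpsih3_SO4 (A : 'M[R]_4) p q w0 w1 w2 : SO4 A ->
  dpsih3 (A *m p) (A *m q) (A *m w0) (A *m w1) (A *m w2) = dpsih3 p q w0 w1 w2.
Proof.
move=> SA; have [AA dA] := SA.
rewrite /dpsih3 (usq_SO4 _ SA) (qinv_SO4 _ SA).
rewrite /v_aaa /v_abb /v_aab /dwedge12 /wedge12 /i_ab /di_ab /i_bb /di_bb.
by inv_tac AA dA.
Qed.

Lemma wedge_SO4 k l (alpha : dform V k) (beta : dform V l) (A : 'M[R]_4) p f :
  (forall p f, alpha (A *m p) (fun i => A *m f i) = alpha p f) ->
  (forall p f, beta (A *m p) (fun i => A *m f i) = beta p f) ->
  wedge alpha beta (A *m p) (fun i => A *m f i) = wedge alpha beta p f.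
Proof.
move=> ha hb; rewrite /wedge; congr (_ * _); apply: eq_bigr => s _.
by rewrite (ha p (fun i => f (s (lshift l i)))) (hb p (fun i => f (s (rshift k i)))).
Qed.

Lemma eta_SO4 (A : 'M[R]_4) p w : SO4 A -> eta (A *m p) (A *m w) = A *m eta p w.
Proof.
move=> SA; have [AA dA] := SA.
rewrite /eta /qf (usq_SO4 _ SA) (qinv_SO4 _ SA); inv_tac AA dA.
by rewrite !mulmxBr -!scalemxAr.
Qed.

Lemma Jpos_SO4 (A : 'M[R]_4) p w : SO4 A -> Jpos (A *m p) (A *m w) = A *m Jpos p w.
Proof.
move=> SA; have [AA dA] := SA.
rewrite /Jpos (qinv_SO4 _ SA) eta_SO4 //; inv_tac AA dA.
by rewrite scalemxAr -mulmxBr.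
Qed.

Lemma JTS_SO4 (A : 'M[R]_4) p w : SO4 A -> JTS (A *m p) (A *m w) = A *m JTS p w.
Proof.
move=> SA; have [AA dA] := SA.
apply: mx_ext; rewrite ?pos_mul ?vel_mul !(pos_mk2, vel_mk2) ?Jpos_SO4 //.
rewrite /Jvel /qf (usq_SO4 _ SA) (qinv_SO4 _ SA) Jpos_SO4 //; inv_tac AA dA.
by rewrite !scalemxAr -!mulmxDr -mulmxBr.
Qed.

Lemma gTS_SO4 (A : 'M[R]_4) p w z : SO4 A ->
  gTS (A *m p) (A *m w) (A *m z) = gTS p w z.
Proof.
move=> SA; have [AA dA] := SA.
by rewrite /gTS !eta_SO4 // (qinv_SO4 _ SA); inv_tac AA dA.
Qed.

(** Volumes are simplified slot by slot before [ring] is called: x and v in normal form cut [vol]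
    down to a small minor, and a tangent vector in the first slot has no component 0. *)
Lemma vol_xv t p b c : nform t p ->
  vol (pos p) (vel p) b c = t * (b o2 0 * c o3 0 - b o3 0 * c o2 0).
Proof.
by case=> x0 x1 x2 x3 v0 v1 v2 v3;
  rewrite volE /det3 x0 x1 x2 x3 v1 v2 v3; ring.
Qed.

Lemma vol_x t p b c d : nform t p ->
  vol (pos p) b c d = det3 (b o1 0) (b o2 0) (b o3 0) (c o1 0) (c o2 0) (c o3 0)
                           (d o1 0) (d o2 0) (d o3 0).
Proof. by case=> x0 x1 x2 x3 _ _ _ _; rewrite volE x0 x1 x2 x3; ring. Qed.

Lemma vol_tv t p q b c : nform t p -> ntan t q ->
  vol (pos q) (vel p) b c
  = t * (pos q o3 0 * (b o0 0 * c o2 0 - b o2 0 * c o0 0)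
         - pos q o2 0 * (b o0 0 * c o3 0 - b o3 0 * c o0 0)).
Proof.
by case=> _ _ _ _ v0 v1 v2 v3 [q0 _]; rewrite volE /det3 q0 v0 v1 v2 v3; ring.
Qed.

Lemma vol_t t q b c d : ntan t q ->
  let D u v := det3 (pos q o1 0) (pos q o2 0) (pos q o3 0) (u o1 0) (u o2 0) (u o3 0)
                    (v o1 0) (v o2 0) (v o3 0) in
  vol (pos q) b c d = c o0 0 * D b d - b o0 0 * D c d - d o0 0 * D b c.
Proof. by move=> [q0 _] D; rewrite volE /D /det3 q0; ring. Qed.

(* Replaces 1 / q by r (1 + t^2) with r = q^-3, so that the closedness identities
   become polynomial identities in r and t. *)
Lemma qinv_rel t p : nform t p ->
  exists2 r, qinv p ^+ 3 = r & qinv p = r * (1 + t ^+ 2).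
Proof.
move=> nfp; exists (qinv p ^+ 3) => //.
have := qinv2 p; rewrite (usq_nf nfp) => h.
by rewrite -[LHS]mulr1 -[X in _ * X = _]h; ring.
Qed.

Lemma extd_psi : form_eq (@TS3 R) (@tTS3 R) (extd (@psi_form R)) (@form0 R _ 4).
Proof.
move=> p f pM fT; rewrite (extd3 (@has_derive_psi3 R)) /form0.
move: p f pM fT; apply: TS3_reduce => [A p f SA|t p f nfp ft].
  by rewrite /alt4 !dpsi3_SO4.
have [a0 b0] := ft o0; have [a1 b1] := ft o1.
have [a2 b2] := ft o2; have [a3 b3] := ft o3.
have [r r1 r2] := qinv_rel nfp.
rewrite /alt4 /dpsi3 (usq_nf nfp) r1 r2.
rewrite /v_aaa /v_abb /v_bbb /dwedge12 /wedge12 /i_aa /di_aa.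
rewrite !(vol_xv _ _ nfp) !(vol_x _ _ _ nfp).
rewrite ?(vol_tv _ _ nfp (ft _)) ?(vol_t _ _ _ (ft _)) !ipE.
rewrite ?(a0, b0, a1, b1, a2, b2, a3, b3); nf_entries nfp.
by rewrite /det3; ring.
Qed.

Lemma extd_psih : @form_eq R V (@TS3 R) (@tTS3 R) 4 (extd (@psih_form R))
  (wedge (@sigma_form R) (@omega_form R)).
Proof.
move=> p f pM fT; rewrite (extd3 (@has_derive_psih3 R)).
move: p f pM fT; apply: TS3_reduce => [A p f SA|t p f nfp ft].
  rewrite wedge_SO4; last 2 first.
  - by move=> ? ?; exact: sigma_SO4.
  - by move=> ? ?; exact: omega_SO4.
  by rewrite /alt4 !dpsih3_SO4.
have -> : wedge (@sigma_form R) (@omega_form R) p f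
        = form_of (@fcoord R) (mul_terms (sigma_terms t (qinv p)) (omega_terms R)) f.
  apply: (@wedge_form_of R V (@fcoord R) (ntan t) 2 2 (@sigma_form R)
    (@omega_form R) (sigma_terms t (qinv p)) (omega_terms R) p) => // h hT.
  - exact: sigma_nf.
  - exact: omega_nf nfp _.
rewrite /form_of /mul_terms /= !big_cons big_nil /= !det_rows4 /fcoord /=.
have [a0 b0] := ft o0; have [a1 b1] := ft o1.
have [a2 b2] := ft o2; have [a3 b3] := ft o3.
have [r r1 r2] := qinv_rel nfp.
rewrite /alt4 /dpsih3 (usq_nf nfp) r1 r2.
rewrite /v_aaa /v_abb /v_aab /dwedge12 /wedge12 /i_ab /di_ab /i_bb /di_bb.
rewrite !(vol_xv _ _ nfp) !(vol_x _ _ _ nfp).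
rewrite ?(vol_tv _ _ nfp (ft _)) ?(vol_t _ _ _ (ft _)) !ipE.
rewrite ?(a0, b0, a1, b1, a2, b2, a3, b3); nf_entries nfp.
by rewrite /det3; ring.
Qed.

End Global.

(** * Identities in degree 6, and g and J in normal form *)

Section Structure.
Variable R : realType.
Local Notation V := 'M[R]_(4, 2).
Implicit Types (p : V) (w z : V) (t q : R).

Lemma det_rows_sg (X : nat -> V -> R) (f : 'I_6 -> V) (I : seq nat) (z : int) :
  all (ltn^~ 6%N) I -> rows_sign 6 I = z ->
  \det (\matrix_(i < 6, j < 6) X (nth 0 I i) (f j))
  = z%:~R * \det (\matrix_(i < 6, j < 6) X i (f j)).
Proof.
move=> hI <-.
rewrite (@det_rows R 6 (fun i j => X i (f j)) I) // => i i6.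
(* Positions past the end of I read the default index 0, which is below 6 as well. *)
have [iI|Ii] := ltnP i (size I); last by rewrite nth_default.
exact: (allP hI) (mem_nth _ iI).
Qed.

(** Turns every 6 by 6 determinant into an integer times the one determinant with the coordinates in
    order, so that only a linear identity in that determinant remains. *)
Ltac eval_dets6 :=
  repeat match goal with |- context [\det (\matrix_(i, j) _ (nth _ ?I _) _)] =>
    let v := eval vm_compute in (rows_sign 6 I) in
    rewrite (@det_rows_sg _ _ I v (erefl true)); [|by vm_cast_no_check (erefl v)]
  end.

(** omega^3 is 6 times dx_1 dv_1 dx_2 dv_2 dx_3 dv_3, and moving the dx before the dv takes three
    transpositions, whence -6. *)
Lemma omega3_nf t p f : nform t p -> (forall i, ntan t (f i)) ->
  wedge (@omega_form R) (wedge (@omega_form R) (@omega_form R)) p f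
  = -6 * \det (\matrix_(i < 6, j < 6) fcoord i (f j)).
Proof.
move=> nfp ft.
have E : wedge (@omega_form R) (wedge (@omega_form R) (@omega_form R)) p f
  = form_of (@fcoord R) (mul_terms (omega_terms R) (mul_terms (omega_terms R) (omega_terms R))) f.
  apply: (@wedge_form_of R V (@fcoord R) (ntan t) 2 4) => // h hT.
    exact: omega_nf nfp _.
  apply: (@wedge_form_of R V (@fcoord R) (ntan t) 2 2) => // h' hT';
    exact: omega_nf nfp _.
rewrite E /form_of /mul_terms /= !big_cons big_nil /=.
eval_dets6; change (Negz 0) with (-1 : int).
by ring.
Qed.

Lemma psi_psih_nf t p f : nform t p -> (forall i, ntan t (f i)) ->
  wedge (@psi_form R) (@psih_form R) p f
  = -4 * \det (\matrix_(i < 6, j < 6) fcoord i (f j)).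
Proof.
move=> nfp ft.
have E : wedge (@psi_form R) (@psih_form R) p f
  = form_of (@fcoord R) (mul_terms (psi_terms t (qinv p)) (psih_terms t (qinv p))) f.
  apply: (@wedge_form_of R V (@fcoord R) (ntan t) 3 3) => // h hT.
    exact: psi_nf.
  exact: psih_nf.
rewrite E /form_of /mul_terms /= !big_cons big_nil /=.
have h := qinv2 p; rewrite (usq_nf nfp) in h.
eval_dets6; change (Negz 0) with (-1 : int).
set D := \det _.
(* The coefficient is grouped so that 1 / q enters only through q^-2 (1 + t^2), which equals 1. *)
transitivity ((- 2 - 2 * (2 + t ^+ 2)
  + 2 * (1 + t ^+ 2) * (qinv p ^+ 2 * (1 + t ^+ 2))) * D); first by ring.
by rewrite h; ring.
Qed.

(** No term of sigma is a multiple of some dx_i dv_i, so every product with omega^2 repeats an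
    index. *)
Lemma sigma_omega2_nf t p f : nform t p -> (forall i, ntan t (f i)) ->
  wedge (@sigma_form R) (wedge (@omega_form R) (@omega_form R)) p f = 0.
Proof.
move=> nfp ft.
have E : wedge (@sigma_form R) (wedge (@omega_form R) (@omega_form R)) p f
  = form_of (@fcoord R)
      (mul_terms (sigma_terms t (qinv p)) (mul_terms (omega_terms R) (omega_terms R))) f.
  apply: (@wedge_form_of R V (@fcoord R) (ntan t) 2 4) => // h hT.
    exact: sigma_nf.
  apply: (@wedge_form_of R V (@fcoord R) (ntan t) 2 2) => // h' hT';
    exact: omega_nf nfp _.
rewrite E /form_of /mul_terms /= !big_cons big_nil /=.
by eval_dets6; ring.
Qed.

(** Makes q the free variable and t^2 = q^2 - 1 the eliminated quantity, so that the identities for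
    g and J become rational in q and are settled by [field]. *)
Lemma nf_rel t p : nform t p -> exists q,
  [/\ qinv p = q^-1, qf p = q, q != 0 & t ^+ 2 = q ^+ 2 - 1].
Proof.
move=> nfp; have h := qinv2 p; rewrite /qf (usq_nf nfp) in h *.
have s0 : qinv p != 0 by rewrite gt_eqF // qinv_gt0.
have E : qinv p * (1 + t ^+ 2) = (qinv p)^-1.
  by apply: (mulfI s0); rewrite divff // -[RHS]h; ring.
exists (qinv p)^-1; split => //; [by rewrite invrK | by rewrite invr_eq0 |].
have -> : t ^+ 2 = (qinv p ^+ 2 * (1 + t ^+ 2)) / qinv p ^+ 2 - 1 by field.
by rewrite h; field.
Qed.

Lemma eta_nf t p w (q := qf p) : nform t p -> ntan t w ->
  [/\ eta p w o0 0 = 0, eta p w o1 0 = vel w o1 0 - q * pos w o1 0,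
      eta p w o2 0 = vel w o2 0 - q * pos w o2 0
    & eta p w o3 0 = vel w o3 0 - q * pos w o3 0].
Proof.
case=> x0 x1 x2 x3 v0 v1 v2 v3 [a0 b0].
have E i : eta p w i 0
  = vel w i 0 - ip (pos p) (vel w) * pos p i 0 - q * pos w i 0.
  by rewrite /eta; move: (ip (pos p) (vel w)) (pos w) (vel w) (pos p) => d a b c; rewrite !mxE.
by rewrite !E ipE x0 x1 x2 x3 a0; split; ring.
Qed.

(** In normal form P is diag (q^2, 1, 1) on the coordinates 1, 2, 3, so only the direction of v
    carries a power of q from P. Here e stands for eta. *)
Lemma J_nf t p w q : nform t p -> ntan t w ->
  qinv p = q^-1 -> qf p = q -> q != 0 -> t ^+ 2 = q ^+ 2 - 1 ->
  let e i := vel w i 0 - q * pos w i 0 in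
  (pos (JTS p w) o0 0 = 0 /\ vel (JTS p w) o0 0 = t * (q ^- 2 * e o1)) /\
  [/\ pos (JTS p w) o1 0 = - (q ^- 2 * e o1), pos (JTS p w) o2 0 = - e o2
    & pos (JTS p w) o3 0 = - e o3] /\
  [/\ vel (JTS p w) o1 0 = q ^+ 2 * pos w o1 0 - q * (q ^- 2 * e o1),
      vel (JTS p w) o2 0 = pos w o2 0 - q * e o2
    & vel (JTS p w) o3 0 = pos w o3 0 - q * e o3].
Proof.
move=> nfp wT hs hs' q0 t2 e.
have [e0 e1 e2 e3] := eta_nf nfp wT; have [a0 b0] := wT.
have [x0 x1 x2 x3 v0 v1 v2 v3] := nfp.
have veta : ip (vel p) (eta p w) = t * e o1.
  by rewrite ipE v0 v1 v2 v3 e0 e1 hs' /e; ring.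
have va : ip (vel p) (pos w) = t * pos w o1 0.
  by rewrite ipE v0 v1 v2 v3; ring.
have JE i : Jpos p w i 0 = q^-1 ^+ 2 * (t * e o1) * vel p i 0 - eta p w i 0.
  by rewrite /Jpos hs veta; move: (eta p w) (vel p) => a b; rewrite !mxE.
have J0 : Jpos p w o0 0 = 0 by rewrite JE v0 e0; ring.
have J1 : Jpos p w o1 0 = - (q ^- 2 * e o1).
  rewrite JE v1 e1 hs' -/(e o1).
  transitivity (q^-1 ^+ 2 * e o1 * t ^+ 2 - e o1); first by ring.
  by rewrite t2; field.
have J2 : Jpos p w o2 0 = - e o2 by rewrite JE v2 e2 hs' -/(e o2); ring.
have J3 : Jpos p w o3 0 = - e o3 by rewrite JE v3 e3 hs' -/(e o3); ring.
have vJ : ip (vel p) (Jpos p w) = - t * (q ^- 2 * e o1).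
  by rewrite ipE v0 v1 v2 v3 J1; ring.
have JvE i : Jvel p w i 0 = q * Jpos p w i 0 + pos w i 0
   + t * pos w o1 0 * vel p i 0 + t * (q ^- 2 * e o1) * pos p i 0.
  rewrite /Jvel hs' va vJ.
  move: (Jpos p w) (pos w) (vel p) (pos p) => a b c d.
  by rewrite !mxE; ring.
rewrite !pos_mk2 !vel_mk2 !JvE J0 J1 J2 J3 x0 x1 x2 x3 v0 v1 v2 v3 a0.
split; first by split; ring.
split; first by [].
split; [|by ring|by ring].
transitivity (q * - (q ^- 2 * e o1) + pos w o1 0 + pos w o1 0 * t ^+ 2); first by ring.
by rewrite t2; ring.
Qed.

Lemma J_ntan t p w : nform t p -> ntan t w -> ntan t (JTS p w).
Proof.
move=> nfp wT; have [q [h1 h2 h3 h4]] := nf_rel nfp.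
rewrite /ntan; have [[-> ->] [[-> _ _] _]] := J_nf nfp wT h1 h2 h3 h4.
by split; ring.
Qed.

(** The forms dx_i and eta_i diagonalise g, with the entries of P and P^-1 as coefficients;
    positivity is then a sum of six squares. *)
Lemma g_nf t p w z q : nform t p -> ntan t w -> ntan t z ->
  qinv p = q^-1 -> qf p = q -> q != 0 -> t ^+ 2 = q ^+ 2 - 1 ->
  let e w i := vel w i 0 - q * pos w i 0 in
  gTS p w z = q ^+ 2 * (pos w o1 0 * pos z o1 0) + pos w o2 0 * pos z o2 0
    + pos w o3 0 * pos z o3 0
    + q ^- 2 * (e w o1 * e z o1) + e w o2 * e z o2 + e w o3 * e z o3.
Proof.
move=> nfp wT zT hs hs' q0 t2 e.
have [e0 e1 e2 e3] := eta_nf nfp wT; have [a0 b0] := wT.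
have [e0' e1' e2' e3'] := eta_nf nfp zT; have [a0' b0'] := zT.
have [x0 x1 x2 x3 v0 v1 v2 v3] := nfp.
rewrite /gTS !ipE x0 x1 x2 x3 v0 v1 v2 v3 e0 e1 e2 e3 e0' e1' e2' e3' a0 b0 a0' b0'.
rewrite hs hs' -/(e w o1) -/(e w o2) -/(e w o3) -/(e z o1) -/(e z o2) -/(e z o3).
transitivity (pos w o1 0 * pos z o1 0 * (1 + t ^+ 2) + pos w o2 0 * pos z o2 0
    + pos w o3 0 * pos z o3 0
    + (1 - q ^- 2 * t ^+ 2) * (e w o1 * e z o1) + e w o2 * e z o2 + e w o3 * e z o3).
  by field.
by rewrite t2; field.
Qed.

End Structure.

(** * The almost Hermitian axioms, the types of the forms, and strictness *)

Section Assembly.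
Variable R : realType.
Local Notation V := 'M[R]_(4, 2).
Implicit Types (p : V) (w z : V) (t q : R).

Lemma volume_identity : @form_eq R V (@TS3 R) (@tTS3 R) 6
  (wedge (@psi_form R) (@psih_form R))
  (fun p f => 2 / 3 *
     wedge (@omega_form R) (wedge (@omega_form R) (@omega_form R)) p f).
Proof.
move=> p f pM fT; move: p f pM fT; apply: TS3_reduce => [A p f SA|t p f nfp ft].
  have ho p' f' := @omega_SO4 R A p' f' SA.
  have hp p' f' := @psi_SO4 R A p' f' SA.
  have hh p' f' := @psih_SO4 R A p' f' SA.
  rewrite (wedge_SO4 (k := 3) (l := 3) _ _ hp hh).
  by rewrite (wedge_SO4 (k := 2) (l := 4) _ _ ho
     (fun p' f' => wedge_SO4 (k := 2) (l := 2) p' f' ho ho)).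
rewrite (psi_psih_nf nfp ft) (omega3_nf nfp ft).
by move: (\det _) => D; field.
Qed.

Lemma sigma_primitive : @form_eq R V (@TS3 R) (@tTS3 R) 6
  (wedge (@sigma_form R) (wedge (@omega_form R) (@omega_form R))) (@form0 R V 6).
Proof.
move=> p f pM fT; move: p f pM fT; apply: TS3_reduce => [A p f SA|t p f nfp ft].
  have ho p' f' := @omega_SO4 R A p' f' SA.
  have hs p' f' := @sigma_SO4 R A p' f' SA.
  by rewrite (wedge_SO4 (k := 2) (l := 4) _ _ hs
     (fun p' f' => wedge_SO4 (k := 2) (l := 2) p' f' ho ho)).
exact: sigma_omega2_nf nfp ft.
Qed.

Lemma SO4_inj (A : 'M[R]_4) p : SO4 A -> A *m p = 0 -> p = 0.
Proof. by move=> [AA _] h; rewrite -[p]mul1mx -AA -mulmxA h mulmx0. Qed.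

Lemma gTS_pos p w : TS3 p -> tTS3 p w -> w != 0 -> 0 < gTS p w w.
Proof.
pose P p (f : unit -> V) := f tt != 0 -> 0 < gTS p (f tt) (f tt).
have H : forall p f, TS3 p -> (forall i, tTS3 p (f i)) -> P p f.
  apply: TS3_reduce => {p w} [A p f SA|t p f nfp ft]; rewrite /P.
    rewrite gTS_SO4 // => h f0; apply: h; apply: contra f0 => /eqP h.
    by apply/eqP; exact: SO4_inj SA h.
  move=> f0; have [q [h1 h2 h3 h4]] := nf_rel nfp.
  rewrite (g_nf nfp (ft tt) (ft tt) h1 h2 h3 h4); move: (ft tt) f0.
  move: (f tt) => w [a0 b0] w0.
  rewrite -exprVn -!expr2 -!exprMn lt_neqAle; apply/andP; split; last first.
    by do !apply: addr_ge0; exact: sqr_ge0.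
  apply: contra w0; rewrite eq_sym !paddr_eq0 ?sqr_ge0 ?addr_ge0 ?sqr_ge0 //.
  rewrite !sqrf_eq0 !mulf_eq0 invr_eq0 (negbTE h3) /=.
  move=> /andP[/andP[/andP[/andP[/andP[/eqP a1 /eqP a2] /eqP a3]]]].
  rewrite a1 a2 a3 !mulr0 !subr0 => /eqP b1 /eqP b2 /eqP b3.
  apply/eqP/mx_ext; apply/colP; apply: ord4P => //.
  - by rewrite a0 !mxE. - by rewrite a1 !mxE. - by rewrite a2 !mxE.
  - by rewrite a3 !mxE. - by rewrite b0 a1 mulr0 !mxE. - by rewrite b1 !mxE.
  - by rewrite b2 !mxE. - by rewrite b3 !mxE.
by move=> pM wT; exact: (H p (fun=> w)).
Qed.

Lemma JTS_tangent p w : TS3 p -> tTS3 p w -> tTS3 p (JTS p w).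
Proof.
pose P p (f : unit -> V) := tTS3 p (JTS p (f tt)).
have H : forall p f, TS3 p -> (forall i, tTS3 p (f i)) -> P p f.
  apply: TS3_reduce => {p w} [A p f SA|t p f nfp ft]; rewrite /P.
    by rewrite JTS_SO4 //; have [AA _] := SA; case; rewrite !pos_mul !vel_mul !ip_mul.
  have [c0 d0] := J_ntan nfp (ft tt).
  have [x0 x1 x2 x3 v0 v1 v2 v3] := nfp.
  by split; rewrite !ipE x0 x1 x2 x3 ?v0 ?v1 ?v2 ?v3 c0 ?d0; ring.
by move=> pM wT; exact: (H p (fun=> w)).
Qed.

Lemma JTS_JTS p w : TS3 p -> tTS3 p w -> JTS p (JTS p w) = - w.
Proof.
pose P p (f : unit -> V) := JTS p (JTS p (f tt)) = - f tt.
have H : forall p f, TS3 p -> (forall i, tTS3 p (f i)) -> P p f.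
  apply: TS3_reduce => {p w} [A p f SA|t p f nfp ft]; rewrite /P.
    move=> h; apply/eqP; rewrite -subr_eq0 opprK; apply/eqP/(SO4_inj SA).
    by rewrite mulmxDr -!JTS_SO4 // h addNr.
  have [q [h1 h2 h3 h4]] := nf_rel nfp.
  have wT := ft tt; have JT := J_ntan nfp wT.
  have [[A0 B0] [[A1 A2 A3] [B1 B2 B3]]] := J_nf nfp JT h1 h2 h3 h4.
  have [[c0 d0] [[c1 c2 c3] [d1 d2 d3]]] := J_nf nfp wT h1 h2 h3 h4.
  have [a0 b0] := wT.
  have N i j : (- f tt) i j = - f tt i j by rewrite mxE.
  have pN i : pos (- f tt) i 0 = - pos (f tt) i 0 by rewrite !mxE.
  have vN i : vel (- f tt) i 0 = - vel (f tt) i 0 by rewrite !mxE.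
  apply/mx_ext; apply/colP; apply: ord4P; rewrite ?pN ?vN.
  - by rewrite A0 a0 oppr0.
  - by rewrite A1 c1 d1; field.
  - by rewrite A2 c2 d2; field.
  - by rewrite A3 c3 d3; field.
  - by rewrite B0 b0 c1 d1; field.
  - by rewrite B1 c1 d1; field.
  - by rewrite B2 c2 d2; field.
  - by rewrite B3 c3 d3; field.
by move=> pM wT; exact: (H p (fun=> w)).
Qed.

(** J exchanges the two halves of g: dx becomes - P^-1 eta and eta becomes P dx, which swaps <P dx,
    dx> with <P^-1 eta, eta>. *)
Lemma gTS_JTS p w z : TS3 p -> tTS3 p w -> tTS3 p z ->
  gTS p (JTS p w) (JTS p z) = gTS p w z.
Proof.
pose P p (f : bool -> V) :=
  gTS p (JTS p (f true)) (JTS p (f false)) = gTS p (f true) (f false).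
have H : forall p f, TS3 p -> (forall i, tTS3 p (f i)) -> P p f.
  apply: TS3_reduce => {p w z} [A p f SA|t p f nfp ft]; rewrite /P.
    by rewrite !JTS_SO4 // !gTS_SO4.
  have [q [h1 h2 h3 h4]] := nf_rel nfp.
  have [wT zT] := (ft true, ft false).
  have E y : ntan t y ->
      [/\ vel (JTS p y) o1 0 - q * pos (JTS p y) o1 0 = q ^+ 2 * pos y o1 0,
          vel (JTS p y) o2 0 - q * pos (JTS p y) o2 0 = pos y o2 0
        & vel (JTS p y) o3 0 - q * pos (JTS p y) o3 0 = pos y o3 0].
    move=> yT; have [_ [[A1 A2 A3] [B1 B2 B3]]] := J_nf nfp yT h1 h2 h3 h4.
    by rewrite /= A1 A2 A3 B1 B2 B3; split; ring.
  have [_ [[A1 A2 A3] _]] := J_nf nfp wT h1 h2 h3 h4.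
  have [_ [[c1 c2 c3] _]] := J_nf nfp zT h1 h2 h3 h4.
  have [E1 E2 E3] := E _ wT; have [F1 F2 F3] := E _ zT.
  have := g_nf nfp (J_ntan nfp wT) (J_ntan nfp zT) h1 h2 h3 h4.
  rewrite (g_nf nfp wT zT h1 h2 h3 h4) => /= ->.
  move: E1 E2 E3 F1 F2 F3 A1 A2 A3 c1 c2 c3.
  move: (JTS p (f true)) (JTS p (f false)) => W Z.
  move=> -> -> -> -> -> -> -> -> -> -> -> ->.
  move: (pos (f true) o1 0) (vel (f true) o1 0) => a1 b1.
  move: (pos (f true) o2 0) (vel (f true) o2 0) => a2 b2.
  move: (pos (f true) o3 0) (vel (f true) o3 0) => a3 b3.
  move: (pos (f false) o1 0) (vel (f false) o1 0) => d1 e1.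
  move: (pos (f false) o2 0) (vel (f false) o2 0) => d2 e2.
  move: (pos (f false) o3 0) (vel (f false) o3 0) => d3 e3.
  by field.
move=> pM wT zT; apply: (H p (fun b => if b then w else z)) => // -[]//.
Qed.

Lemma omega_fundamental :
  form_eq (@TS3 R) (@tTS3 R) (@omega_form R) (fundamental_form (@gTS R) (@JTS R)).
Proof.
move=> p f pM fT; move: p f pM fT; apply: TS3_reduce => [A p f SA|t p f nfp ft].
  by rewrite /fundamental_form omega_SO4 // JTS_SO4 // gTS_SO4.
rewrite (omega_nf nfp ft) /fundamental_form.
have [q [h1 h2 h3 h4]] := nf_rel nfp.
have [h0 [[ha1 ha2 ha3] [hb1 hb2 hb3]]] := J_nf nfp (ft 0) h1 h2 h3 h4.
rewrite (g_nf nfp (J_ntan nfp (ft 0)) (ft 1) h1 h2 h3 h4).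
rewrite ha1 ha2 ha3 hb1 hb2 hb3.
rewrite /form_of /omega_terms !big_cons big_nil /= !det_rows2 /fcoord.
by field.
Qed.

(** In normal form sigma is a multiple of dx_2 dx_3 + eta_2 eta_3. For i = 2, 3 the matrix P acts as
    the identity, so J exchanges dx_i and eta_i up to sign and swaps the two summands. *)
Lemma type11_sigma : type11 (@TS3 R) (@tTS3 R) (@JTS R) (@sigma_form R).
Proof.
move=> p f pM fT; move: p f pM fT; apply: TS3_reduce => [A p f SA|t p f nfp ft].
  move=> h; rewrite -(sigma_SO4 p f SA) -h.
  rewrite -(sigma_SO4 p (fun i => JTS p (f i)) SA).
  have -> : (fun i => A *m JTS p (f i)) = (fun i => JTS (A *m p) (A *m f i)).
    by apply/funext => i; rewrite JTS_SO4.
  by [].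
rewrite (sigma_nf nfp ft) (sigma_nf nfp (fun i => J_ntan nfp (ft i))).
have [q [h1 h2 h3 h4]] := nf_rel nfp.
rewrite /form_of /sigma_terms !big_cons !big_nil /= !det_rows2 /fcoord h1 h4 /=.
move: (ft 0) (ft 1); move: (f 0) (f 1) => w z wT zT.
have [_ [[_ ha2 ha3] [_ hb2 hb3]]] := J_nf nfp wT h1 h2 h3 h4.
have [_ [[_ ka2 ka3] [_ kb2 kb3]]] := J_nf nfp zT h1 h2 h3 h4.
move: ha2 ha3 hb2 hb3 ka2 ka3 kb2 kb3; move: (JTS p w) (JTS p z) => W Z.
move=> -> -> -> -> -> -> -> ->.
by field.
Qed.

Lemma type30_psi : type30 (@TS3 R) (@tTS3 R) (@JTS R) (@psi_form R) (@psih_form R).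
Proof.
(* H collects the real and the imaginary part of the complex identity. *)
suff H : forall p (f : 'I_3 -> V), TS3 p -> (forall i, tTS3 p (f i)) ->
    forall i, psi_form p f = psih_form p [eta f with i |-> JTS p (f i)] /\
              psih_form p f = - psi_form p [eta f with i |-> JTS p (f i)].
  move=> p f pM fT i; have [-> ->] := H p f pM fT i.
  by apply/eqP; rewrite eq_complex /=; apply/andP; split; apply/eqP; ring.
apply: TS3_reduce => [A p f SA H i|t p f nfp ft i].
  have E : ([eta (fun i => A *m f i) with i |-> JTS (A *m p) (A *m f i)] : 'I_3 -> V)
         = (fun j => A *m [eta f with i |-> JTS p (f i)] j).
    by apply/funext => j /=; case: (j == i) => //; rewrite JTS_SO4.
  by have := H i; rewrite E !psi_SO4 // !psih_SO4.
have ft' j : ntan t ([eta f with i |-> JTS p (f i)] j).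
  by rewrite /=; case: (j == i) => //; exact: J_ntan.
rewrite (psi_nf nfp ft) (psih_nf nfp ft) (psi_nf nfp ft') (psih_nf nfp ft').
have [q [h1 h2 h3 h4]] := nf_rel nfp.
rewrite /form_of /psi_terms /psih_terms !big_cons !big_nil /= !det_rows3 /fcoord h1 h4.
move: i {ft'}; apply: ord3P => /=.
- have [_ [[ha1 ha2 ha3] [hb1 hb2 hb3]]] := J_nf nfp (ft k0) h1 h2 h3 h4.
  move: ha1 ha2 ha3 hb1 hb2 hb3; move: (JTS p (f k0)) => W -> -> -> -> -> ->.
  move: (f k0) (f k1) (f k2) => w0 w1 w2.
  by rewrite /det3; split; field.
- have [_ [[ha1 ha2 ha3] [hb1 hb2 hb3]]] := J_nf nfp (ft k1) h1 h2 h3 h4.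
  move: ha1 ha2 ha3 hb1 hb2 hb3; move: (JTS p (f k1)) => W -> -> -> -> -> ->.
  move: (f k0) (f k1) (f k2) => w0 w1 w2.
  by rewrite /det3; split; field.
- have [_ [[ha1 ha2 ha3] [hb1 hb2 hb3]]] := J_nf nfp (ft k2) h1 h2 h3 h4.
  move: ha1 ha2 ha3 hb1 hb2 hb3; move: (JTS p (f k2)) => W -> -> -> -> -> ->.
  move: (f k0) (f k1) (f k2) => w0 w1 w2.
  by rewrite /det3; split; field.
Qed.

Lemma almost_hermitian_TS3 : almost_hermitian (@TS3 R) (@tTS3 R) (@gTS R) (@JTS R).
Proof.
split; last by move=> p u v; exact: gTS_JTS.
- split.
  + exists setT; split => //; [exact: openT | |by move=> u v; exact: gTS_smooth].
    move=> p _ c u v w; split; first exact: gTS_linl.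
    by rewrite gTS_sym gTS_linl !(gTS_sym p w).
  + by move=> *; exact: gTS_sym.
  + by move=> p u; exact: gTS_pos.
- split.
  + exists setT; split => //; [exact: openT | |by move=> u; exact: JTS_smooth].
    by move=> p _ c u v; exact: JTS_lin.
  + by move=> p u; exact: JTS_tangent.
  + by move=> p u; exact: JTS_JTS.
Qed.

Lemma SU3_structure_TS3 : SU3_structure (@TS3 R) (@tTS3 R) (@gTS R) (@JTS R)
  (@omega_form R) (@psi_form R) (@psih_form R).
Proof.
split; first by split; [exact: omega_smooth|exact: psi_smooth|exact: psih_smooth].
split; [exact: almost_hermitian_TS3|exact: omega_fundamental|exact: type30_psi|].
exact: volume_identity.
Qed.

(** sigma vanishes where v = 0, so a point off the zero section is needed; this one has t = 1. *)
Definition test_point : V := mk2 (delta_mx o0 0) (delta_mx o1 0).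

Lemma strict_TS3 : strict (@TS3 R) (@tTS3 R) (@JTS R) (@omega_form R) (@psih_form R).
Proof.
exists (@sigma_form R).
  split; [exact: sigma_smooth|exact: type11_sigma|exact: sigma_primitive|].
  exact: extd_psih.
move=> h.
pose f (i : 'I_2) : V := if i == 0 then mk2 (delta_mx o2 0) 0 else mk2 (delta_mx o3 0) 0.
have pM : TS3 test_point.
  by split; rewrite /test_point !pos_mk2 ?vel_mk2 ipE !mxE /=; ring.
have fT i : tTS3 test_point (f i).
  by rewrite /f; case: (i == 0); split;
    rewrite /test_point !pos_mk2 ?vel_mk2 !ipE !mxE /=; ring.
have := h test_point f pM fT; rewrite /form0 /sigma_form /sig2 /f /= /i_aa /i_bb /i_ab.
rewrite /usq !pos_mk2 !vel_mk2 !volE !ipE /det3 !mxE /=.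
have s0 := qinv_gt0 test_point.
move=> e; suff : qinv test_point = 0 by move=> e0; rewrite e0 ltxx in s0.
(* With dx = e_2, e_3 and dv = 0, only 3 (2 + t^2) t / q survives in sigma, which is 9 / q at t =
   1. *)
apply: (mulfI (x := 9)); first by rewrite pnatr_eq0.
by rewrite mulr0 -[RHS]e; ring.
Qed.

End Assembly.

(** * Completeness *)

(** Lagrange's identity: the difference of the two sides is a sum of six squares. *)
Lemma ip_CS (R : realType) (a b : 'cV[R]_4) : ip a b ^+ 2 <= ip a a * ip b b.
Proof.
rewrite -subr_ge0 !ipE.
move: (a o0 0) (a o1 0) (a o2 0) (a o3 0) (b o0 0) (b o1 0) (b o2 0) (b o3 0).
move=> a0 a1 a2 a3 b0 b1 b2 b3.
rewrite (_ : _ - _ = (a0 * b1 - a1 * b0) ^+ 2 + (a0 * b2 - a2 * b0) ^+ 2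
  + (a0 * b3 - a3 * b0) ^+ 2 + (a1 * b2 - a2 * b1) ^+ 2
  + (a1 * b3 - a3 * b1) ^+ 2 + (a2 * b3 - a3 * b2) ^+ 2); last by ring.
by do !apply: addr_ge0; exact: sqr_ge0.
Qed.

Lemma ip_coord (R : realType) (a : 'cV[R]_4) i : a i 0 ^+ 2 <= ip a a.
Proof.
rewrite /ip (bigD1 i) //= -expr2 lerDl sumr_ge0 // => j _.
by rewrite -expr2 sqr_ge0.
Qed.

Lemma ler_norm_sqrt (R : realType) (x y : R) : x ^+ 2 <= y -> `|x| <= Num.sqrt y.
Proof.
move=> h; rewrite -(ler_sqr (x := `|x|)) ?nnegrE ?sqrtr_ge0 //.
by rewrite sqr_sqrtr ?(le_trans (sqr_ge0 x)) // real_normK ?num_real.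
Qed.

Section MetricBounds.
Variable R : realType.
Local Notation V := 'M[R]_(4, 2).
Implicit Types (p w : V).

Lemma qf2 p : qf p ^+ 2 = 1 + usq p.
Proof.
rewrite /qf exprMn.
by rewrite [X in _ * X]expr2 mulrA qinv2 mul1r.
Qed.

Lemma qinv_qf p : qinv p * qf p = 1.
Proof. by rewrite /qf mulrA -expr2 qinv2. Qed.

Lemma qf_ge1 p : 1 <= qf p.
Proof.
have q0 : 0 < qf p by rewrite mulr_gt0 ?qinv_gt0 ?usq1_gt0.
have : 1 ^+ 2 <= qf p ^+ 2 by rewrite qf2 expr1n lerDl ip_ge0.
by rewrite ler_sqr // nnegrE ltW.
Qed.

Lemma qinv_le1 p : qinv p <= 1.
Proof.
have := qinv_qf p; have := qf_ge1 p; have := qinv_gt0 p; nra.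
Qed.

(** The right side is <P^-1 e, e>. The eigenvalues of P^-1 are 1 and q^-2, the latter along v, and
    the lower bound amounts to Cauchy-Schwarz for v and e. *)
Lemma eta_part_ge p (e : 'cV[R]_4) :
  qinv p ^+ 2 * ip e e <= ip e e - qinv p ^+ 2 * (ip (vel p) e * ip (vel p) e).
Proof.
have h := qinv2 p; have cs := ip_CS (vel p) e; rewrite -/(usq p) in cs.
have s0 := sqr_ge0 (qinv p).
rewrite -subr_ge0 (_ : _ - _ - _ = qinv p ^+ 2 * (usq p * ip e e - ip (vel p) e ^+ 2)).
  by rewrite mulr_ge0 // subr_ge0.
by rewrite -[X in X - _ - _]mul1r -[X in X * _ - _ - _]h; ring.
Qed.

Lemma gTS_bounds p w (G := gTS p w w) :
  [/\ ip (pos w) (pos w) <= G, ip (vel p) (pos w) ^+ 2 <= G,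
      qinv p ^+ 2 * ip (eta p w) (eta p w) <= G
    & (ip (pos p) (vel w) + ip (vel p) (pos w)) ^+ 2 <= G].
Proof.
rewrite /G /gTS; have h := eta_part_ge p (eta p w).
have h0 := ip_ge0 (eta p w); have h1 := ip_ge0 (pos w).
have h2 := sqr_ge0 (ip (vel p) (pos w)).
have h3 := sqr_ge0 (ip (pos p) (vel w) + ip (vel p) (pos w)).
have h4 : 0 <= qinv p ^+ 2 * ip (eta p w) (eta p w) by rewrite mulr_ge0 // sqr_ge0.
move: h h1 h2 h3 h4; rewrite -!expr2.
set A := ip (pos w) (pos w); set B := ip (vel p) (pos w) ^+ 2.
set C := qinv p ^+ 2 * ip (eta p w) (eta p w).
set D := (ip (pos p) (vel w) + _) ^+ 2.
set E := ip (eta p w) (eta p w) - _.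
by move=> *; split; lra.
Qed.

Lemma gTS_ge0 p w : 0 <= gTS p w w.
Proof. by have [h _ _ _] := gTS_bounds p w; exact: le_trans (ip_ge0 _) h. Qed.

Lemma pos_le p w i : `|pos w i 0| <= Num.sqrt (gTS p w w).
Proof.
apply: ler_norm_sqrt; have [h _ _ _] := gTS_bounds p w.
exact: le_trans (ip_coord _ _) h.
Qed.

Lemma eta_le p w i : `|eta p w i 0| <= qf p * Num.sqrt (gTS p w w).
Proof.
have s0 := qinv_gt0 p.
rewrite -(ler_pM2l s0) mulrA qinv_qf mul1r -{1}(gtr0_norm s0) -normrM.
apply: ler_norm_sqrt; have [_ _ h _] := gTS_bounds p w.
by apply: le_trans h; rewrite exprMn ler_pM2l ?exprn_gt0 // ip_coord.
Qed.

Lemma TS3_pos_le1 p i : TS3 p -> `|pos p i 0| <= 1.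
Proof.
move=> [h _]; rewrite -sqrtr1; apply: ler_norm_sqrt; rewrite -[leRHS]h.
exact: ip_coord.
Qed.

(** The last square in [gTS] bounds <x, dv> + <v, dx>, and <v, dx> is bounded on its own; each
    contributes 1 to the factor 2. *)
Lemma posvel_le p w : `|ip (pos p) (vel w)| <= 2 * Num.sqrt (gTS p w w).
Proof.
have [_ h2 _ h4] := gTS_bounds p w.
have := ler_norm_sqrt h2; have := ler_norm_sqrt h4.
move: (ip (pos p) (vel w)) (ip (vel p) (pos w)) (Num.sqrt _) => x y G.
by rewrite !ler_norml => /andP[? ?] /andP[? ?]; apply/andP; split; lra.
Qed.

(** In dv = eta + <x, dv> x + q dx the three terms contribute q, 2 and q, and 1 <= q gives 4 q. *)
Lemma vel_le p w i : TS3 p ->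
  `|vel w i 0| <= 4 * qf p * Num.sqrt (gTS p w w).
Proof.
move=> pM; have h1 := pos_le p w i; have h2 := eta_le p w i.
have h3 := posvel_le p w; have h4 := TS3_pos_le1 i pM; have q1 := qf_ge1 p.
have S0 : 0 <= Num.sqrt (gTS p w w) by exact: sqrtr_ge0.
have -> : vel w i 0 = eta p w i 0 + ip (pos p) (vel w) * pos p i 0
                      + qf p * pos w i 0.
  rewrite /eta; move: (ip (pos p) (vel w)) (pos p) (pos w) (vel w) => c a b d.
  by rewrite !mxE; ring.
have h5 : `|ip (pos p) (vel w) * pos p i 0| <= 2 * Num.sqrt (gTS p w w) * 1.
  by rewrite normrM ler_pM.
have h6 : `|qf p * pos w i 0| <= qf p * Num.sqrt (gTS p w w).
  by rewrite normrM (ger0_norm (le_trans ler01 q1)) ler_wpM2l // (le_trans ler01 q1).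
apply: le_trans (ler_normD _ _) _; apply: le_trans (lerD (ler_normD _ _) (lexx _)) _.
apply: le_trans (lerD (lerD h2 h5) h6) _.
move: (Num.sqrt _) S0 (qf p) q1 => S S0 q q1; nra.
Qed.

(** Since x.v = 0, <v, dv> = <v, eta> + q <v, dx>. As |v| <= q and |eta| is at most q times the
    g-norm, the first term costs q^2 and the second q <= q^2. The growth like q^2 is what the
    logarithm in [gLip_ln] absorbs. *)
Lemma velvel_le p w : TS3 p ->
  `|ip (vel p) (vel w)| <= 2 * qf p ^+ 2 * Num.sqrt (gTS p w w).
Proof.
move=> pM; have [_ hx] := pM; have [_ h2 h3 _] := gTS_bounds p w.
have q1 := qf_ge1 p; have s0 := qinv_gt0 p.
have S0 : 0 <= Num.sqrt (gTS p w w) by exact: sqrtr_ge0.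
have -> : ip (vel p) (vel w) = ip (vel p) (eta p w) + qf p * ip (vel p) (pos w).
  have : ip (vel p) (eta p w) = ip (vel p) (vel w)
     - ip (pos p) (vel w) * ip (vel p) (pos p) - qf p * ip (vel p) (pos w).
    rewrite /eta; move: (ip (pos p) (vel w)) => c.
    by rewrite !ipE !mxE; ring.
  by move=> ->; rewrite (ipC (vel p) (pos p)) hx; ring.
have h5 : `|qinv p * ip (vel p) (eta p w)| <= qf p * Num.sqrt (gTS p w w).
  rewrite -[X in X * Num.sqrt _]ger0_norm ?(le_trans ler01 q1) //.
  rewrite -(sqrtr_sqr (qf p)) -sqrtrM ?sqr_ge0 //; apply: ler_norm_sqrt.
  rewrite exprMn; apply: (@le_trans _ _ (usq p * gTS p w w)); last first.
    by rewrite ler_wpM2r ?gTS_ge0 // qf2 lerDr.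
  apply: (@le_trans _ _ (usq p * (qinv p ^+ 2 * ip (eta p w) (eta p w)))).
    by rewrite [leRHS]mulrCA ler_wpM2l ?sqr_ge0 // ip_CS.
  by rewrite ler_wpM2l // ip_ge0.
have h6 : `|ip (vel p) (eta p w)| <= qf p ^+ 2 * Num.sqrt (gTS p w w).
  have -> : ip (vel p) (eta p w) = qf p * (qinv p * ip (vel p) (eta p w)).
    by rewrite mulrA (mulrC (qf p)) qinv_qf mul1r.
  rewrite normrM (ger0_norm (le_trans ler01 q1)) expr2 -mulrA.
  by rewrite ler_wpM2l // (le_trans ler01 q1).
have h7 : `|qf p * ip (vel p) (pos w)| <= qf p * Num.sqrt (gTS p w w).
  rewrite normrM (ger0_norm (le_trans ler01 q1)) ler_wpM2l ?(le_trans ler01 q1) //.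
  exact: ler_norm_sqrt.
apply: le_trans (ler_normD _ _) _; apply: le_trans (lerD h6 h7) _.
move: (Num.sqrt _) S0 (qf p) q1 => S S0 q q1.
have -> : 2 * q ^+ 2 * S = q ^+ 2 * S + q * S * q by ring.
by rewrite lerD2l ler_peMr // mulr_ge0 // (le_trans ler01 q1).
Qed.

End MetricBounds.

(** * Functions that are Lipschitz for the Riemannian distance *)

Section Lipschitz.
Variable R : realType.
Local Notation V := 'M[R]_(4, 2).
Implicit Types (p w : V).

Lemma continuous_add (f g : R -> R) :
  continuous f -> continuous g -> continuous (fun t => f t + g t).
Proof. by move=> hf hg t; apply: continuousD; [exact: hf | exact: hg]. Qed.
Lemma continuous_sub (f g : R -> R) :
  continuous f -> continuous g -> continuous (fun t => f t - g t).
Proof. by move=> hf hg t; apply: continuousB; [exact: hf | exact: hg]. Qed.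
Lemma continuous_mul (f g : R -> R) :
  continuous f -> continuous g -> continuous (fun t => f t * g t).
Proof. by move=> hf hg t; apply: continuousM; [exact: hf | exact: hg]. Qed.
Lemma continuous_cst (a : R) : continuous (fun _ : R => a).
Proof. by move=> t; exact: cvg_cst. Qed.
Lemma continuous_exp (f : R -> R) n : continuous f -> continuous (fun t => f t ^+ n).
Proof.
move=> hf; elim: n => [|n IH]; first exact: continuous_cst.
rewrite (_ : (fun t => _) = (fun t => f t * f t ^+ n)); first exact: continuous_mul.
by apply/funext => r; rewrite exprS.
Qed.

Lemma continuous_entry (c : R -> V) i j : continuous c -> continuous (fun t => c t i j).
Proof.
move=> hc t; apply: (@continuous_comp _ _ _ c (fun M : V => M i j)); first exact: hc.
exact: coord_continuous.
Qed.

Lemma continuous_ip (A B : R -> 'cV[R]_4) :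
  (forall i, continuous (fun t => A t i 0)) ->
  (forall i, continuous (fun t => B t i 0)) -> continuous (fun t => ip (A t) (B t)).
Proof.
move=> hA hB.
rewrite (_ : (fun t => _) = (fun t => A t o0 0 * B t o0 0 + A t o1 0 * B t o1 0
   + A t o2 0 * B t o2 0 + A t o3 0 * B t o3 0)); last first.
  by apply/funext => t; rewrite ipE.
by do ?apply: continuous_add; apply: continuous_mul.
Qed.

Lemma continuous_col (c : R -> V) i j : continuous c ->
  continuous (fun t => col j (c t) i 0).
Proof.
move=> hc; rewrite (_ : (fun t => _) = (fun t => c t i j)).
  exact: continuous_entry.
by apply/funext => t; rewrite mxE.
Qed.

Lemma continuous_qinv (c : R -> V) : continuous c -> continuous (fun t => qinv (c t)).
Proof.
move=> hc t; apply: (@continuous_comp _ _ _ c (@qinv R)); first exact: hc.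
exact/differentiable_continuous/(@has_derive_qinv R (c t)).1.
Qed.

Lemma continuous_qf (c : R -> V) : continuous c -> continuous (fun t => qf (c t)).
Proof.
move=> hc; apply: continuous_mul; first exact: continuous_qinv.
apply: continuous_add; first exact: continuous_cst.
by apply: continuous_ip => i; exact: continuous_col.
Qed.

Lemma continuous_gTS (c d : R -> V) : continuous c -> continuous d ->
  continuous (fun t => gTS (c t) (d t) (d t)).
Proof.
move=> hc hd.
have E i : continuous (fun t => eta (c t) (d t) i 0).
  rewrite (_ : (fun t => _) = (fun t => vel (d t) i 0
     - ip (pos (c t)) (vel (d t)) * pos (c t) i 0 - qf (c t) * pos (d t) i 0)).
    do ?apply: continuous_sub; try apply: continuous_mul;
     solve [exact: continuous_col | exact: continuous_qf
     | by apply: continuous_ip => k; exact: continuous_col].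
  apply/funext => t; rewrite /eta; move: (ip (pos (c t)) (vel (d t))) (pos (c t)) => a b.
  by move: (vel (d t)) (pos (d t)) => x y; rewrite !mxE.
have I j k (x y : bool) : continuous (fun t => ip (col j (if x then c t else d t))
   (col k (if y then c t else d t))).
  by apply: continuous_ip => i; [case: x|case: y]; exact: continuous_col.
have I1 := I 0 0 false false; have I2 := I 1 0 true false.
have I3 := I 0 1 true false.
have J1 : continuous (fun t => ip (eta (c t) (d t)) (eta (c t) (d t))).
  by apply: continuous_ip.
have J2 : continuous (fun t => ip (vel (c t)) (eta (c t) (d t))).
  by apply: continuous_ip => // i; exact: continuous_col.
have S2 : continuous (fun t => qinv (c t) ^+ 2).
  by apply: continuous_exp; exact: continuous_qinv.
rewrite /gTS; apply: continuous_add; [apply: continuous_add; [apply: continuous_add|]|].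
- exact: I1.
- by apply: continuous_mul; exact: I2.
- apply: continuous_sub; first exact: J1.
  by apply: continuous_mul; [exact: S2|apply: continuous_mul; exact: J2].
- by apply: continuous_mul; apply: continuous_add; first [exact: I3|exact: I2].
Qed.

Definition speed (c : R -> V) t := Num.sqrt (gTS (c t) (derive1 c t) (derive1 c t)).

Lemma continuous_speed (c : R -> V) : C1_curve (@TS3 R) c -> continuous (speed c).
Proof.
move=> [dc cc _] t; apply: (@continuous_comp _ _ _
   (fun t => gTS (c t) (derive1 c t) (derive1 c t)) Num.sqrt).
  apply: continuous_gTS => // u.
  exact/differentiable_continuous/derivable1_diffP.
exact: sqrt_continuous.
Qed.

(** The constant 8 is the largest that occurs, in [gLip_vel]. The continuity clause makes the
    fundamental theorem of calculus available along C^1 curves. *)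
Definition gLip (F : V -> R) := exists dF, [/\ has_derive F dF,
  forall p w, TS3 p -> `|dF p w| <= 8 * Num.sqrt (gTS p w w)
  & forall c d : R -> V, continuous c -> continuous d ->
      continuous (fun t => dF (c t) (d t))].

Lemma gLip_pos i : gLip (fun p => pos p i 0).
Proof.
exists (fun _ w => pos w i 0); split.
- by apply: has_derive_lin => k u v; rewrite posD !mxE.
- move=> p w _; apply: le_trans (pos_le p w i) _.
  by rewrite ler_peMl ?sqrtr_ge0 // ler1n.
- by move=> c d _ hd; exact: continuous_col.
Qed.

(** Along a ray in a fibre the length element of g is dt / q with q^2 = 1 + t^2, so lengths grow
    like a logarithm. The function bounds |v| on Cauchy sequences. *)
Lemma gLip_ln : gLip (fun p => ln (1 + usq p)).
Proof.
have H := @has_derive_comp R (fun p => 1 + usq p) _ (@ln R) GRing.inv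
  (has_derive_add (has_derive_cst 1) (@has_derive_usq R)) (fun p => is_derive1_ln (usq1_gt0 p)).
exists (fun p w => 2 * (qinv p ^+ 2 * ip (vel p) (vel w))); split.
- apply: has_derive_ext H _ _ => // p w.
  have := qinv2 p; have u0 : 1 + usq p != 0 by rewrite gt_eqF // usq1_gt0.
  move=> h; have -> : qinv p ^+ 2 = (1 + usq p)^-1.
    by apply: (mulIf u0); rewrite h mulVf.
  by ring.
- move=> p w pM; have h := velvel_le w pM.
  rewrite normrM normrM (ger0_norm (sqr_ge0 (qinv p))) (ger0_norm (ler0n _ 2)).
  have E := qinv_qf p.
  apply: (@le_trans _ _ (2 * (qinv p ^+ 2 * (2 * qf p ^+ 2 * Num.sqrt (gTS p w w))))).
    by rewrite ler_wpM2l // ler_wpM2l // sqr_ge0.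
  rewrite (_ : 2 * _ = 4 * (qinv p * qf p) ^+ 2 * Num.sqrt (gTS p w w)); last by ring.
  by rewrite E expr1n mulr1 ler_wpM2r ?sqrtr_ge0 // ler_nat.
- move=> c d hc hd; apply: continuous_mul; first exact: continuous_cst.
  apply: continuous_mul; first by apply: continuous_exp; exact: continuous_qinv.
  by apply: continuous_ip => i; exact: continuous_col.
Qed.

(** The bound on dv_i grows like q, hence the division by q^2. The two terms of the product rule
    contribute 4 each. *)
Lemma gLip_vel i : gLip (fun p => vel p i 0 * qinv p ^+ 2).
Proof.
have Hv : has_derive (fun p : V => vel p i 0) (fun _ w => vel w i 0).
  by apply: has_derive_lin => k u v; rewrite velD !mxE.
have H := has_derive_mul Hv (has_derive_mul (@has_derive_qinv R) (@has_derive_qinv R)).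
exists (fun p w => - 2 * vel p i 0 * qinv p ^+ 4 * ip (vel p) (vel w)
                   + qinv p ^+ 2 * vel w i 0); split.
- by apply: has_derive_ext H _ _ => // p w; rewrite /=; ring.
- move=> p w pM; have h := velvel_le w pM; have h' := vel_le w i pM.
  have vi : `|vel p i 0| <= qf p.
    rewrite -[leRHS]ger0_norm ?(le_trans ler01 (qf_ge1 p)) // -(sqrtr_sqr (qf p)).
    apply: ler_norm_sqrt; rewrite qf2; apply: le_trans (ip_coord _ _) _.
    by rewrite lerDr.
  have E := qinv_qf p; have s1 := qinv_le1 p; have s0 := qinv_gt0 p.
  apply: le_trans (ler_normD _ _) _.
  move: h h' vi; move: (ip (vel p) (vel w)) (vel w i 0) (vel p i 0) => x y z.
  move: (Num.sqrt (gTS p w w)) (sqrtr_ge0 (gTS p w w)) => S S0 h h' vi.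
  rewrite (normrM _ x) (normrM (- 2 * z)) (normrM _ z) (normrM _ y) !normrX normrN.
  rewrite (ger0_norm (ltW s0)) (ger0_norm (ler0n _ 2)).
  have A1 : 2 * `|z| * qinv p ^+ 4 * `|x| <= 4 * S.
    apply: (@le_trans _ _ (2 * qf p * qinv p ^+ 4 * (2 * qf p ^+ 2 * S))).
      apply: ler_pM => //; first by apply: mulr_ge0; [exact: mulr_ge0 | exact/exprn_ge0/ltW].
      by rewrite ler_wpM2r ?exprn_ge0 ?(ltW s0) // ler_wpM2l.
    rewrite (_ : _ * _ = 4 * (qinv p * qf p) ^+ 3 * qinv p * S); last by ring.
    by rewrite E expr1n mulr1 ler_wpM2r // ler_piMr.
  have A2 : qinv p ^+ 2 * `|y| <= 4 * S.
    apply: (@le_trans _ _ (qinv p ^+ 2 * (4 * qf p * S))).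
      by rewrite ler_wpM2l // sqr_ge0.
    rewrite (_ : _ * _ = 4 * (qinv p * qf p) * qinv p * S); last by ring.
    by rewrite E mulr1 ler_wpM2r // ler_piMr.
  by apply: le_trans (lerD A1 A2) _; rewrite le_eqVlt; apply/orP; left; apply/eqP; ring.
- move=> c d hc hd; have Cs := continuous_qinv hc.
  apply: continuous_add; apply: continuous_mul.
  + apply: continuous_mul; last exact: continuous_exp.
    by apply: continuous_mul; [exact: continuous_cst|exact: continuous_col].
  + by apply: continuous_ip => k; exact: continuous_col.
  + exact: continuous_exp.
  + exact: continuous_col.
Qed.

Lemma derive_comp_curve (F : V -> R) dF (c : R -> V) t :
  has_derive F dF -> derivable c t 1 ->
  is_derive t 1 (fun t => F (c t)) (dF (c t) (derive1 c t)).
Proof.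
move=> hF /derivable1_diffP dc; have [f1 f2] := hF (c t).
have D : differentiable (fun t => F (c t)) t.
  exact: (@differentiable_comp _ _ _ _ c F).
apply: DeriveDef; first exact/derivable1_diffP.
rewrite -f2 derive1E (deriveE _ dc) (deriveE _ f1) (deriveE _ D).
by rewrite (@diff_comp _ _ _ _ c F).
Qed.

(** The increment of F is the integral of dF along the velocity, and dF is at most 8 times the speed
    at the points of the curve. *)
Lemma curve_lip F (c : R -> V) : gLip F -> C1_curve (@TS3 R) c ->
  (`|F (c 1%R) - F (c 0%R)|%:E <= 8%:E * curve_length (@gTS R) c)%E.
Proof.
move=> [dF [hF hb hc]] Cc; have [dc cc cM] := Cc.
pose f t := dF (c t) (derive1 c t).
have contc : continuous c.
  by move=> t; exact/differentiable_continuous/derivable1_diffP.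
have cf : continuous f by exact: hc.
have D t := derive_comp_curve hF (dc t).
have dphi t : derivable (fun t => F (c t)) t 1 by have [] := D t.
have cphi : continuous (fun t => F (c t)).
  by move=> t; exact/differentiable_continuous/derivable1_diffP.
have FTC := @continuous_FTC2 R f (fun t => F (c t)) 0 1 ltr01 _ _ _.
have {}FTC : (\int[lebesgue_measure]_(x in `[0%R, 1%R]) (f x)%:E
   = (F (c 1%R))%:E - (F (c 0%R))%:E)%E.
  apply: FTC.
  - exact: continuous_subspaceT.
  - split; first by move=> x _.
    + by apply: cvg_at_right_filter; exact: cphi.
    + by apply: cvg_at_left_filter; exact: cphi.
  - by move=> x _; rewrite derive1E; have [] := D x.
have mI : measurable `[(0 : R), (1 : R)]%classic by exact: measurable_itv.
have mf (h : R -> R) : continuous h ->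
    measurable_fun `[(0 : R), (1 : R)]%classic (EFin \o h).
  move=> ch; apply/measurable_EFinP; apply: measurable_funTS.
  exact: continuous_measurable_fun.
rewrite -[(`|_|%:E)%E]abse_EFin EFinB -FTC.
apply: (@le_trans _ _ (\int[lebesgue_measure]_(x in `[0%R, 1%R]) `|(f x)%:E|)%E).
  by apply: le_abse_integral; [exact: mI | exact: mf].
have ms := continuous_speed Cc.
apply: (@le_trans _ _ (\int[lebesgue_measure]_(x in `[0%R, 1%R])
   (8%:E * (speed c x)%:E))%E).
  apply: ge0_le_integral => //.
  - by apply: measurableT_comp => //; exact: mf.
  - by apply: (mf (fun x => 8 * speed c x)); apply: continuous_mul;
      [exact: continuous_cst|].
  - move=> x; rewrite /= in_itv /= => x01.
    by rewrite -EFinM lee_fin; apply: hb; exact: cM.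
rewrite ge0_integralZl_EFin //.
- by move=> x _; rewrite lee_fin sqrtr_ge0.
- exact: mf.
Qed.

Lemma curve_length_ge0 (c : R -> V) : (0 <= curve_length (@gTS R) c)%E.
Proof. by apply: integral_ge0 => x _; rewrite lee_fin sqrtr_ge0. Qed.

Lemma path_lip F (cs : seq (R -> V)) p q : gLip F -> joins (@TS3 R) cs p q ->
  (`|F q - F p|%:E <= 8%:E * path_length (@gTS R) cs)%E.
Proof.
move=> hF; rewrite /path_length; elim: cs p => [|c cs IH] p /=.
  by move=> ->; rewrite subrr normr0 big_nil mule0.
move=> [Cc <- J]; rewrite big_cons ge0_muleDr ?curve_length_ge0 //; last first.
  by apply: sume_ge0 => *; exact: curve_length_ge0.
apply: le_trans (leeD (curve_lip hF Cc) (IH _ J)).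
rewrite -EFinD lee_fin.
have -> : F q - F (c 0) = (F (c 1) - F (c 0)) + (F q - F (c 1)) by ring.
exact: ler_normD.
Qed.

Lemma dist_lip F p q (e : R) : gLip F ->
  (riemannian_dist (@TS3 R) (@gTS R) p q < e%:E)%E -> `|F q - F p| <= 8 * e.
Proof.
move=> hF /ereal_inf_lt[_ /= [cs J <-] le].
rewrite -lee_fin; apply: le_trans (path_lip hF J) _.
by rewrite EFinM lee_wpmul2l // ltW.
Qed.

End Lipschitz.

(** * Cauchy sequences converge entrywise to a point of TS3 *)

Section Limit.
Local Open Scope classical_set_scope.
Local Open Scope ring_scope.
Variable R : realType.
Local Notation V := 'M[R]_(4, 2).
Implicit Types (p w : V).

Lemma cauchy_real_cvg (u : nat -> R) :
  (forall e, 0 < e -> exists N, forall m n, (N <= m)%N -> (N <= n)%N ->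
     `|u n - u m| < e) -> cvg (u n @[n --> \oo]).
Proof.
move=> h; apply/cauchy_cvgP/cauchy_exP => e e0.
have [N hN] := h e e0; exists (u N); exists N => // n /= Nn.
by rewrite /ball /= distrC; apply: hN.
Qed.

Lemma dist_cauchy_cvg (x : nat -> V) F : gLip F ->
  (forall e : R, 0 < e -> exists N, forall m n, (N <= m)%N -> (N <= n)%N ->
       (riemannian_dist (@TS3 R) (@gTS R) (x m) (x n) < e%:E)%E) ->
  cvg (F (x n) @[n --> \oo]).
Proof.
move=> hF h; apply: cauchy_real_cvg => e e0.
(* The Lipschitz constant 8 turns e / 16 into e / 2, which leaves room for the strict inequality. *)
have [|N hN] := h (e / 16); first by rewrite divr_gt0.
exists N => m n Nm Nn; apply: le_lt_trans (dist_lip hF (hN m n Nm Nn)) _.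
by lra.
Qed.

Lemma cvg_ip (a b : nat -> 'cV[R]_4) (A B : 'cV[R]_4) :
  (forall i, a n i 0 @[n --> \oo] --> A i 0) ->
  (forall i, b n i 0 @[n --> \oo] --> B i 0) ->
  ip (a n) (b n) @[n --> \oo] --> (ip A B : R).
Proof.
move=> ha hb.
rewrite (_ : (fun n => _) = (fun n => a n o0 0 * b n o0 0 + a n o1 0 * b n o1 0
   + a n o2 0 * b n o2 0 + a n o3 0 * b n o3 0)); last first.
  by apply/funext => n; rewrite ipE.
rewrite ipE.
by do 3?[apply: cvgD]; apply: cvgM; first [exact: ha | exact: hb].
Qed.

(** v_i is the product of v_i / q^2 and exp (ln (q^2)), whose factors both converge. The equations
    x.x = 1 and x.v = 0 pass to the limit. *)
Lemma cauchy_limit (x : nat -> V) : (forall n, TS3 (x n)) ->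
  (forall e : R, 0 < e -> exists N, forall m n, (N <= m)%N -> (N <= n)%N ->
       (riemannian_dist (@TS3 R) (@gTS R) (x m) (x n) < e%:E)%E) ->
  exists2 p, TS3 p & forall i j, x n i j @[n --> \oo] --> p i j.
Proof.
move=> xM xC.
have cX i : cvg (pos (x n) i 0 @[n --> \oo]) := dist_cauchy_cvg (@gLip_pos R i) xC.
have cL : cvg (ln (1 + usq (x n)) @[n --> \oo]) := dist_cauchy_cvg (@gLip_ln R) xC.
have cW i : cvg (vel (x n) i 0 * qinv (x n) ^+ 2 @[n --> \oo]) :=
  dist_cauchy_cvg (@gLip_vel R i) xC.
pose a : 'cV[R]_4 := \col_i lim (pos (x n) i 0 @[n --> \oo]).
pose L := lim (ln (1 + usq (x n)) @[n --> \oo]).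
pose b : 'cV[R]_4 := \col_i (lim (vel (x n) i 0 * qinv (x n) ^+ 2 @[n --> \oo])
   * expR L).
have ca i : pos (x n) i 0 @[n --> \oo] --> a i 0 by rewrite mxE.
have cb i : vel (x n) i 0 @[n --> \oo] --> b i 0.
  rewrite mxE (_ : (fun n => _) = (fun n => vel (x n) i 0 * qinv (x n) ^+ 2
      * expR (ln (1 + usq (x n))))).
    apply: cvgM; first exact: cW.
    by apply: continuous_cvg; [exact: continuous_expR|exact: cL].
  apply/funext => n; rewrite lnK ?posrE ?usq1_gt0 //.
  by rewrite -mulrA qinv2 mulr1.
exists (mk2 a b).
  split; rewrite pos_mk2 ?vel_mk2.
  - have := cvg_ip ca ca; rewrite (_ : (fun n => _) = (fun=> 1)).
      by move/cvg_lim => <- //; rewrite lim_cst.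
    by apply/funext => n; have [] := xM n.
  - have := cvg_ip ca cb; rewrite (_ : (fun n => _) = (fun=> 0)).
      by move/cvg_lim => <- //; rewrite lim_cst.
    by apply/funext => n; have [] := xM n.
move=> i; elim/ord2P; rewrite mxE /=.
- by have := ca i; rewrite (_ : (fun n => _) = (fun n => x n i 0)) //;
    apply/funext => n; rewrite mxE.
- by have := cb i; rewrite (_ : (fun n => _) = (fun n => x n i 1)) //;
    apply/funext => n; rewrite mxE.
Qed.

End Limit.

(** * An explicit curve in TS3 between two nearby points *)

Section ShortCurve.
Variable R : realType.
Local Notation V := 'M[R]_(4, 2).
Implicit Types (z w : V) (t : R).

Definition has_derive1 (f df : R -> R) := forall t, is_derive t (1 : R) f (df t).

Lemma has_derive1_cst a : has_derive1 (fun=> a) (fun=> 0).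
Proof. by move=> t; exact: is_derive_cst. Qed.

Lemma has_derive1_id : has_derive1 id (fun=> 1).
Proof. by move=> t; exact: is_derive_id. Qed.

Lemma has_derive1_add f g df dg : has_derive1 f df -> has_derive1 g dg ->
  has_derive1 (fun t => f t + g t) (fun t => df t + dg t).
Proof. by move=> hf hg t; exact: (@is_deriveD _ _ _ f g). Qed.

Lemma has_derive1_mul f g df dg : has_derive1 f df -> has_derive1 g dg ->
  has_derive1 (fun t => f t * g t) (fun t => f t * dg t + g t * df t).
Proof. by move=> hf hg t; exact: (@is_deriveM _ _ f g). Qed.

Lemma has_derive1_ext f g df dg : has_derive1 f df -> (forall t, f t = g t) ->
  (forall t, df t = dg t) -> has_derive1 g dg.
Proof. by move=> h /funext <- e t; rewrite -e. Qed.

Lemma has_derive1_opp f df : has_derive1 f df -> has_derive1 (fun t => - f t) (fun t => - df t).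
Proof. by move=> hf t; exact: (@is_deriveN _ _ _ f). Qed.

Lemma has_derive1_sub f g df dg : has_derive1 f df -> has_derive1 g dg ->
  has_derive1 (fun t => f t - g t) (fun t => df t - dg t).
Proof. by move=> hf hg; apply: has_derive1_add => //; exact: has_derive1_opp. Qed.

Lemma has_derive1_rsqrt f df : has_derive1 f df -> (forall t, 0 < f t) ->
  has_derive1 (fun t => (Num.sqrt (f t))^-1)
     (fun t => - ((Num.sqrt (f t))^-1) ^+ 3 / 2 * df t).
Proof.
move=> hf f0 t; have [d1 d2] := hf t.
have q0 : Num.sqrt (f t) != 0 by rewrite gt_eqF // sqrtr_gt0.
have [s1 s2] := is_derive1_sqrt (f0 t).
pose g (x : R) := (Num.sqrt x)^-1.
have g1 : derivable g (f t) 1 by exact: derivableV q0 s1.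
have g2 : 'D_1 g (f t) = - (Num.sqrt (f t))^-1 ^+ 3 / 2.
  by rewrite /g (deriveV q0 s1) s2 /GRing.scale /=; field.
have /derivable1_diffP dg := g1; have /derivable1_diffP dff := d1.
have D : differentiable (fun t => g (f t)) t.
  exact: (@differentiable_comp _ _ _ _ f g).
apply: DeriveDef; first exact/derivable1_diffP.
have E := @derive1_comp _ f g t d1 g1.
by rewrite !derive1E g2 d2 in E.
Qed.

Lemma has_derive1_ip (A B dA dB : R -> 'cV[R]_4) :
  (forall i, has_derive1 (fun t => A t i 0) (fun t => dA t i 0)) ->
  (forall i, has_derive1 (fun t => B t i 0) (fun t => dB t i 0)) ->
  has_derive1 (fun t => ip (A t) (B t)) (fun t => ip (dA t) (B t) + ip (A t) (dB t)).
Proof.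
move=> hA hB.
have H i := has_derive1_mul (hA i) (hB i).
apply: has_derive1_ext (has_derive1_add (has_derive1_add (has_derive1_add (H o0) (H o1)) (H o2)) (H o3)) _ _ => t.
  by rewrite ipE.
by rewrite !ipE; ring.
Qed.

Lemma continuous_mx (C : R -> V) :
  (forall i j, continuous (fun t => C t i j)) -> continuous C.
Proof.
move=> h t; apply/cvg_ballP => r r0.
have H : \forall s \near t, forall i j, ball (C t i j) r (C s i j).
  apply: (@filter_forall R 'I_4 (fun i s => forall j, ball (C t i j) r (C s i j)) (nbhs t) _) => i.
  apply: (@filter_forall R 'I_2 (fun j s => ball (C t i j) r (C s i j)) (nbhs t) _) => j.
  by move: (h i j t) => /cvg_ballP/(_ _ r0).
by apply: filterS H => s Hs; split.
Qed.

Variables p z : V.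
Let d : 'cV[R]_4 := pos p - pos z.
Let e : 'cV[R]_4 := vel p - vel z.
(* The straight segment from z to p, retracted onto TS3 by ccurve. *)
Definition lpos t := pos z + t *: d.
Definition lvel t := vel z + t *: e.
Definition lnrm t := ip (lpos t) (lpos t).
Definition lrs t := (Num.sqrt (lnrm t))^-1.
Definition cpos t := lrs t *: lpos t.
(** The projection of [lvel] orthogonal to [lpos], multiplied by |lpos|^2. This avoids a division,
    and the factor is 1 at the two ends when these lie in TS3. *)
Definition cvel t := lnrm t *: lvel t - ip (lpos t) (lvel t) *: lpos t.
Definition ccurve t := mk2 (cpos t) (cvel t).
Definition dcpos t := lrs t *: d - (lrs t ^+ 3 * ip (lpos t) d) *: lpos t.
Definition dcvel t := (2 * ip (lpos t) d) *: lvel t + lnrm t *: e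
  - (ip d (lvel t) + ip (lpos t) e) *: lpos t - ip (lpos t) (lvel t) *: d.
Definition dccurve t := mk2 (dcpos t) (dcvel t).

(** Asked for every real t because [C1_curve] requires derivability on the whole line. *)
Hypothesis lnrm_gt0 : forall t, 0 < lnrm t.

Lemma has_derive1_lpos i : has_derive1 (fun t => lpos t i 0) (fun=> d i 0).
Proof.
have H := has_derive1_add (has_derive1_cst (pos z i 0)) (has_derive1_mul has_derive1_id (has_derive1_cst (d i 0))).
apply: has_derive1_ext H _ _ => t /=; last by ring.
by rewrite /lpos; move: d (pos z) => a b; rewrite !mxE.
Qed.

Lemma has_derive1_lvel i : has_derive1 (fun t => lvel t i 0) (fun=> e i 0).
Proof.
have H := has_derive1_add (has_derive1_cst (vel z i 0)) (has_derive1_mul has_derive1_id (has_derive1_cst (e i 0))).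
apply: has_derive1_ext H _ _ => t /=; last by ring.
by rewrite /lvel; move: e (vel z) => a b; rewrite !mxE.
Qed.

Lemma has_derive1_lnrm : has_derive1 lnrm (fun t => 2 * ip (lpos t) d).
Proof.
apply: has_derive1_ext (has_derive1_ip (dA := fun=> d) (dB := fun=> d) has_derive1_lpos has_derive1_lpos) _ _ => // t.
by rewrite (ipC d); ring.
Qed.

Lemma has_derive1_lrs : has_derive1 lrs (fun t => - lrs t ^+ 3 * ip (lpos t) d).
Proof.
apply: has_derive1_ext (has_derive1_rsqrt has_derive1_lnrm lnrm_gt0) _ _ => // t.
by rewrite /lrs; field; rewrite gt_eqF // sqrtr_gt0.
Qed.

Lemma has_derive1_cpos i : has_derive1 (fun t => cpos t i 0) (fun t => dcpos t i 0).
Proof.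
apply: has_derive1_ext (has_derive1_mul has_derive1_lrs (has_derive1_lpos i)) _ _ => t; rewrite /cpos /dcpos.
  by rewrite [RHS]mxE.
by move: (ip (lpos t) d) (lpos t) d => c a b; rewrite !mxE; ring.
Qed.

Lemma has_derive1_cvel i : has_derive1 (fun t => cvel t i 0) (fun t => dcvel t i 0).
Proof.
have H1 := has_derive1_mul has_derive1_lnrm (has_derive1_lvel i).
have H2 := has_derive1_mul (has_derive1_ip (dA := fun=> d) (dB := fun=> e) has_derive1_lpos has_derive1_lvel) (has_derive1_lpos i).
apply: has_derive1_ext (has_derive1_sub H1 H2) _ _ => t; rewrite /cvel /dcvel.
  by move: (ip (lpos t) (lvel t)) (lpos t) (lvel t) => c a b; rewrite !mxE.
move: (ip (lpos t) d) (ip (lpos t) (lvel t)) (ip d (lvel t)) (ip (lpos t) e).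
move=> c1 c2 c3 c4; move: (lpos t) (lvel t) d e => a b u v.
by rewrite !mxE; ring.
Qed.

Lemma has_derive1_ccurve i j : has_derive1 (fun t => ccurve t i j) (fun t => dccurve t i j).
Proof.
by elim/ord2P: j; [apply: has_derive1_ext (has_derive1_cpos i) _ _ | apply: has_derive1_ext (has_derive1_cvel i) _ _] => t;
  rewrite [RHS]mxE.
Qed.

Lemma has_derive1_continuous f df : has_derive1 f df -> continuous f.
Proof.
move=> h t; have [h1 _] := h t.
by apply/differentiable_continuous/derivable1_diffP.
Qed.

Lemma ccurve_derive1 : derive1 ccurve = dccurve.
Proof.
apply/funext => t; rewrite derive1E.
have dc : derivable ccurve t 1.
  by apply/derivable_mxP => i j; have [] := has_derive1_ccurve i j t.
rewrite derive_mx //; apply/matrixP => i j; rewrite mxE.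
by have [_ ->] := has_derive1_ccurve i j t.
Qed.

Lemma continuous_dccurve : continuous dccurve.
Proof.
have c1 i := has_derive1_continuous (has_derive1_lpos i); have c2 i := has_derive1_continuous (has_derive1_lvel i).
have c3 := has_derive1_continuous has_derive1_lnrm; have c4 := has_derive1_continuous has_derive1_lrs.
have cst (a : 'cV[R]_4) i : continuous (fun _ : R => a i 0).
  exact: continuous_cst.
have I1 := continuous_ip c1 (cst d); have I2 := continuous_ip c1 c2.
have I3 := continuous_ip (cst d) c2; have I4 := continuous_ip c1 (cst e).
apply: continuous_mx => i; elim/ord2P.
- rewrite (_ : (fun t => _) = (fun t =>
     lrs t * d i 0 - (lrs t ^+ 3 * ip (lpos t) d) * lpos t i 0)).
    have K1 := continuous_mul c4 (cst d i).
    have K2 := continuous_mul (continuous_mul (continuous_exp (n := 3) c4) I1) (c1 i).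
    exact: continuous_sub K1 K2.
  apply/funext => t; rewrite mxE /= /dcpos.
  by move: (ip (lpos t) d) (lpos t) d => c a b; rewrite !mxE.
- rewrite (_ : (fun t => _) = (fun t => (2 * ip (lpos t) d) * lvel t i 0
     + lnrm t * e i 0 - (ip d (lvel t) + ip (lpos t) e) * lpos t i 0
     - ip (lpos t) (lvel t) * d i 0)).
    have K1 := continuous_mul (continuous_mul (@continuous_cst R 2) I1) (c2 i).
    have K2 := continuous_add K1 (continuous_mul c3 (cst e i)).
    have K3 := continuous_sub K2 (continuous_mul (continuous_add I3 I4) (c1 i)).
    exact: continuous_sub K3 (continuous_mul I2 (cst d i)).
  apply/funext => t; rewrite mxE /= /dcvel.
  move: (ip (lpos t) d) (ip (lpos t) (lvel t)) (ip d (lvel t)) (ip (lpos t) e).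
  move=> x1 x2 x3 x4; move: (lpos t) (lvel t) d e => a b u v.
  by rewrite !mxE.
Qed.

Lemma ccurve_TS3 t : TS3 (ccurve t).
Proof.
have n0 := lnrm_gt0 t; rewrite /ccurve /cpos /cvel.
have r2 : lrs t ^+ 2 * lnrm t = 1.
  by rewrite /lrs exprVn sqr_sqrtr ?ltW // mulVf // gt_eqF.
split; rewrite pos_mk2 ?vel_mk2.
  rewrite -[RHS]r2 /lnrm; move: (lpos t) (lrs t) => a r.
  by rewrite !ipE !mxE; ring.
rewrite /lnrm; move: (lpos t) (lvel t) (lrs t) => a b r.
by rewrite !ipE !mxE; ring.
Qed.

Lemma ccurve_C1 : C1_curve (@TS3 R) ccurve.
Proof.
split; last by move=> t _; exact: ccurve_TS3.
- by move=> t; apply/derivable_mxP => i j; have [] := has_derive1_ccurve i j t.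
- by rewrite ccurve_derive1; exact: continuous_dccurve.
Qed.

End ShortCurve.

(** * Uniform estimates of the form O(delta^n) *)

Section Orders.
Variables (R : realType) (T : Type) (D : T -> Prop) (delta : T -> R).
Hypothesis delta_ge0 : forall x, D x -> 0 <= delta x.
Implicit Types f g : T -> R.

(** f = O(delta^n) uniformly on D. Orders add under products, so the speed of the short curve can be
    estimated without tracking explicit constants. *)
Definition Odelta n f :=
  exists2 C, 0 <= C & forall x, D x -> `|f x| <= C * delta x ^+ n.

Lemma Odelta_add n f g : Odelta n f -> Odelta n g -> Odelta n (fun x => f x + g x).
Proof.
move=> [C C0 hf] [C' C'0 hg]; exists (C + C'); first exact: addr_ge0.
move=> x Dx; apply: le_trans (ler_normD _ _) _.
by rewrite mulrDl lerD ?hf ?hg.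
Qed.

Lemma Odelta_opp n f : Odelta n f -> Odelta n (fun x => - f x).
Proof. by move=> [C C0 hf]; exists C => // x Dx; rewrite normrN hf. Qed.

Lemma Odelta_sub n f g : Odelta n f -> Odelta n g -> Odelta n (fun x => f x - g x).
Proof. by move=> hf hg; apply: Odelta_add => //; exact: Odelta_opp. Qed.

Lemma Odelta_mul n m f g : Odelta n f -> Odelta m g -> Odelta (n + m) (fun x => f x * g x).
Proof.
move=> [C C0 hf] [C' C'0 hg]; exists (C * C'); first exact: mulr_ge0.
by move=> x Dx; rewrite normrM exprD mulrACA ler_pM ?hf ?hg.
Qed.

Lemma Odelta_exp f k : Odelta 0 f -> Odelta 0 (fun x => f x ^+ k).
Proof.
move=> hf; elim: k => [|k [C C0 IH]].
  by exists 1 => // x _; rewrite expr0 normr1 mul1r.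
have [C' C'0 h] := Odelta_mul hf (ex_intro2 _ _ C C0 IH).
by exists C' => // x Dx; rewrite exprS h.
Qed.

Lemma Odelta_le n f (g : T -> R) : Odelta n g -> (forall x, D x -> `|f x| <= `|g x|) -> Odelta n f.
Proof. by move=> [C C0 h] fg; exists C => // x Dx; apply: le_trans (fg x Dx) (h x Dx). Qed.

Lemma Odelta_cst c : Odelta 0 (fun=> c).
Proof. by exists `|c| => // x _; rewrite expr0 mulr1. Qed.

Definition Odeltav n (A : T -> 'cV[R]_4) := forall i, Odelta n (fun x => A x i 0).

Lemma Odelta_ext n f g : Odelta n f -> (forall x, f x = g x) -> Odelta n g.
Proof. by move=> [C C0 h] e; exists C => // x Dx; rewrite -e h. Qed.

Lemma Odelta_ip n m A B : Odeltav n A -> Odeltav m B -> Odelta (n + m) (fun x => ip (A x) (B x)).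
Proof.
move=> hA hB; have H i := Odelta_mul (hA i) (hB i).
apply: Odelta_ext (Odelta_add (Odelta_add (Odelta_add (H o0) (H o1)) (H o2)) (H o3)) _ => x.
by rewrite ipE.
Qed.

Lemma Odeltav_add n A B : Odeltav n A -> Odeltav n B -> Odeltav n (fun x => A x + B x).
Proof.
move=> hA hB i; apply: Odelta_ext (Odelta_add (hA i) (hB i)) _ => x.
by rewrite [RHS]mxE.
Qed.

Lemma Odeltav_opp n A : Odeltav n A -> Odeltav n (fun x => - A x).
Proof.
by move=> hA i; apply: Odelta_ext (Odelta_opp (hA i)) _ => x; rewrite [RHS]mxE.
Qed.

Lemma Odeltav_sub n A B : Odeltav n A -> Odeltav n B -> Odeltav n (fun x => A x - B x).
Proof. by move=> hA hB; apply: Odeltav_add => //; exact: Odeltav_opp. Qed.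

Lemma Odeltav_scale n m f A : Odelta n f -> Odeltav m A -> Odeltav (n + m) (fun x => f x *: A x).
Proof.
move=> hf hA i; apply: Odelta_ext (Odelta_mul hf (hA i)) _ => x.
by rewrite [RHS]mxE.
Qed.

(** g is quadratic in w, and its coefficients stay bounded as long as the base point does. *)
Lemma Odelta_gTS (c w : T -> 'M[R]_(4, 2)) :
  Odeltav 0 (fun x => pos (c x)) -> Odeltav 0 (fun x => vel (c x)) ->
  Odeltav 1 (fun x => pos (w x)) -> Odeltav 1 (fun x => vel (w x)) ->
  Odelta 2 (fun x => gTS (c x) (w x) (w x)).
Proof.
move=> h1 h2 h3 h4.
have hs : Odelta 0 (fun x => qinv (c x)).
  apply: Odelta_le (Odelta_cst 1) _ => x _.
  by rewrite normr1 ger0_norm ?qinv_le1 // ltW // qinv_gt0.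
have hs' : Odelta 0 (fun x => qf (c x)).
  exact: Odelta_mul hs (Odelta_add (Odelta_cst 1) (Odelta_ip h2 h2)).
have he : Odeltav 1 (fun x => eta (c x) (w x)).
  have K1 := Odeltav_scale (Odelta_ip h1 h4) h1.
  exact: Odeltav_sub (Odeltav_sub h4 K1) (Odeltav_scale hs' h3).
have K1 := Odelta_ip h3 h3.
have K2 := Odelta_ip h2 h3.
have K3 := Odelta_ip he he.
have K4 := Odelta_ip h2 he.
have K5 := Odelta_add (Odelta_ip h1 h4) K2.
exact: Odelta_add (Odelta_add (Odelta_add K1 (Odelta_mul K2 K2))
  (Odelta_sub K3 (Odelta_mul (Odelta_exp 2 hs) (Odelta_mul K4 K4)))) (Odelta_mul K5 K5).
Qed.

End Orders.

(** * Entrywise convergence implies convergence for the Riemannian distance *)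

Section Completeness.
Variable R : realType.
Local Notation V := 'M[R]_(4, 2).
Implicit Types (p z w : V) (t : R).

Definition l1dist (p z : V) : R := \sum_i \sum_j `|z i j - p i j|.

Lemma l1dist_ge0 p z : 0 <= l1dist p z.
Proof. by apply: sumr_ge0 => i _; apply: sumr_ge0 => j _. Qed.

Lemma l1dist_entry p z i j : `|z i j - p i j| <= l1dist p z.
Proof.
rewrite /l1dist (bigD1 i) //= (bigD1 j) //= -addrA lerDl.
by apply: addr_ge0; apply: sumr_ge0 => k _ //; apply: sumr_ge0.
Qed.

(** For unit vectors the squared norm along the segment is 1 - 2 k t (1 - t) with k = 1 - <z, p> in
    their x parts. Here 0 <= k <= 1, the upper bound from k = <p - z, p>, and t (1 - t) <= 1/4 for
    every real t. *)
Lemma lnrm_ge p z : TS3 p -> TS3 z -> l1dist p z <= 1 ->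
  forall t, 2^-1 <= lnrm p z t.
Proof.
move=> [p1 _] [z1 _] dz t.
set k := 1 - ip (pos z) (pos p).
have kle : k <= 1.
  have -> : k = \sum_i (pos p i 0 - pos z i 0) * pos p i 0.
    rewrite /k -p1 /ip -sumrB; apply: eq_bigr => i _.
    by rewrite mulrBl.
  apply: le_trans dz; rewrite /l1dist; apply: ler_sum => i _.
  apply: le_trans (ler_norm _) _; rewrite normrM.
  apply: (@le_trans _ _ `|pos p i 0 - pos z i 0|).
    rewrite ler_piMr // -sqrtr1 -p1; apply: ler_norm_sqrt; exact: ip_coord.
  by rewrite distrC !mxE (bigD1 0) //= lerDl sumr_ge0.
have k0 : 0 <= k.
  have := ip_CS (pos z) (pos p); rewrite p1 z1 mulr1 /k.
  by move: (ip _ _) => y hy; nra.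
have -> : lnrm p z t = 1 - 2 * k * (t * (1 - t)).
  have -> : lnrm p z t = (1 - t) ^+ 2 * ip (pos z) (pos z)
     + 2 * t * (1 - t) * ip (pos z) (pos p) + t ^+ 2 * ip (pos p) (pos p).
    rewrite /lnrm /lpos; move: (pos z) (pos p) => a b.
    by rewrite !ipE !mxE; ring.
  by rewrite p1 z1 /k; ring.
have q : t * (1 - t) <= 4^-1.
  rewrite -subr_ge0 (_ : _ - _ = (t - 2^-1) ^+ 2) ?sqr_ge0 //; by field.
by nra.
Qed.

Lemma ccurve0 p z : TS3 z -> ccurve p z 0 = z.
Proof.
move=> [z1 z2].
have e1 : lpos p z 0 = pos z by rewrite /lpos scale0r addr0.
have e2 : lvel p z 0 = vel z by rewrite /lvel scale0r addr0.
have e3 : lnrm p z 0 = 1 by rewrite /lnrm e1.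
apply: mx_ext; rewrite ?pos_mk2 ?vel_mk2.
  by rewrite /cpos /lrs e3 e1 sqrtr1 invr1 scale1r.
by rewrite /cvel e3 e1 e2 z2 scale1r scale0r subr0.
Qed.

Lemma ccurve1 p z : TS3 p -> ccurve p z 1 = p.
Proof.
move=> [z1 z2].
have e1 : lpos p z 1 = pos p by rewrite /lpos scale1r addrC subrK.
have e2 : lvel p z 1 = vel p by rewrite /lvel scale1r addrC subrK.
have e3 : lnrm p z 1 = 1 by rewrite /lnrm e1.
apply: mx_ext; rewrite ?pos_mk2 ?vel_mk2.
  by rewrite /cpos /lrs e3 e1 sqrtr1 invr1 scale1r.
by rewrite /cvel e3 e1 e2 z2 scale1r scale0r subr0.
Qed.

(** The estimates run over pairs (z, t), so the constant is uniform in both: the curve has order 0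
    in [l1dist] and its velocity order 1, hence g of the velocity has order 2. *)
Lemma speed_bound p : TS3 p -> exists2 C : R, 0 <= C &
  forall z t, TS3 z -> l1dist p z <= 1 -> 0 <= t <= 1 ->
    speed (ccurve p z) t <= C * l1dist p z.
Proof.
move=> pM.
pose D (x : V * R) := [/\ TS3 x.1, l1dist p x.1 <= 1 & 0 <= x.2 <= 1].
pose dl (x : V * R) := l1dist p x.1.
have dl0 x : D x -> 0 <= dl x by move=> _; exact: l1dist_ge0.
have Bt : Odelta D dl 0 (fun x => x.2).
  exists 1 => // x [_ _ /andP[t0 t1]]; by rewrite expr0 mulr1 ger0_norm.
have Bd i j : Odelta D dl 1 (fun x => p i j - x.1 i j).
  by exists 1 => // x _; rewrite mul1r expr1 distrC l1dist_entry.
have Bz i j : Odelta D dl 0 (fun x => x.1 i j).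
  exists (1 + `|p i j|) => [|x [_ h _]]; first by rewrite addr_ge0.
  rewrite expr0 mulr1 -[x.1 i j](subrK (p i j)); apply: le_trans (ler_normD _ _) _.
  by rewrite lerD2r; apply: le_trans (l1dist_entry _ _ _ _) h.
have Bpos j : Odeltav D dl 0 (fun x => col j x.1).
  by move=> i; apply: Odelta_ext (Bz i j) _ => x; rewrite mxE.
have Bcol j : Odeltav D dl 1 (fun x => col j p - col j x.1).
  by move=> i; apply: Odelta_ext (Bd i j) _ => x; rewrite !mxE.
have weak A : Odeltav D dl 1 A -> Odeltav D dl 0 A.
  move=> h i; have [C C0 hC] := h i; exists C => // x Dx.
  apply: le_trans (hC x Dx) _; rewrite expr0 expr1 ler_wpM2l //.
  by have [] := Dx.
have Bl j : Odeltav D dl 0 (fun x => col j x.1 + x.2 *: (col j p - col j x.1)).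
  exact: Odeltav_add (Bpos j) (Odeltav_scale Bt (weak _ (Bcol j))).
have BX : Odeltav D dl 0 (fun x => lpos p x.1 x.2) := Bl 0.
have BY : Odeltav D dl 0 (fun x => lvel p x.1 x.2) := Bl 1.
have Bn : Odelta D dl 0 (fun x => lnrm p x.1 x.2) := Odelta_ip BX BX.
have Br : Odelta D dl 0 (fun x => lrs p x.1 x.2).
  (* From lnrm >= 1/2 >= (1/2)^2 the inverse square root is at most 2. *)
  exists 2 => // x [xM xd _]; rewrite expr0 mulr1.
  have h := lnrm_ge pM xM xd x.2.
  rewrite /lrs ger0_norm ?invr_ge0 ?sqrtr_ge0 // -[leRHS]invrK lef_pV2 ?posrE //; last first.
    by rewrite sqrtr_gt0; apply: lt_le_trans h.
  rewrite -[leLHS]ger0_norm // -(sqrtr_sqr 2^-1) ler_sqrt; last first.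
    by apply: le_trans h.
  by apply: le_trans h; lra.
have BXd := Odelta_ip BX (Bcol 0).
have Bcp : Odeltav D dl 0 (fun x => cpos p x.1 x.2) := Odeltav_scale Br BX.
have Bcv : Odeltav D dl 0 (fun x => cvel p x.1 x.2).
  exact: Odeltav_sub (Odeltav_scale Bn BY) (Odeltav_scale (Odelta_ip BX BY) BX).
have Bdp : Odeltav D dl 1 (fun x => dcpos p x.1 x.2).
  exact: Odeltav_sub (Odeltav_scale Br (Bcol 0)) (Odeltav_scale (Odelta_mul (Odelta_exp 3 Br) BXd) BX).
have Bdv : Odeltav D dl 1 (fun x => dcvel p x.1 x.2).
  have K1 := Odeltav_scale (Odelta_mul (Odelta_cst D dl 2) BXd) BY.
  have K2 := Odeltav_scale Bn (Bcol 1).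
  have K3 := Odeltav_scale (Odelta_add (Odelta_ip (Bcol 0) BY) (Odelta_ip BX (Bcol 1))) BX.
  have K4 := Odeltav_scale (Odelta_ip BX BY) (Bcol 0).
  exact: Odeltav_sub (Odeltav_sub (Odeltav_add K1 K2) K3) K4.
have H : Odelta D dl 2 (fun x => gTS (ccurve p x.1 x.2) (dccurve p x.1 x.2) (dccurve p x.1 x.2)).
  apply: Odelta_gTS => // i; rewrite /ccurve /dccurve.
  - by apply: Odelta_ext (Bcp i) _ => x; rewrite pos_mk2.
  - by apply: Odelta_ext (Bcv i) _ => x; rewrite vel_mk2.
  - by apply: Odelta_ext (Bdp i) _ => x; rewrite pos_mk2.
  - by apply: Odelta_ext (Bdv i) _ => x; rewrite vel_mk2.
(* The square root of the order 2 bound is linear in [l1dist]. *)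
have [C C0 hC] := H; exists (Num.sqrt C); first exact: sqrtr_ge0.
move=> z t zM zd t01; have hl t' : 0 < lnrm p z t'.
  by apply: lt_le_trans (lnrm_ge pM zM zd t').
rewrite /speed (ccurve_derive1 hl).
have := hC (z, t) (And3 zM zd t01); rewrite /= ger0_norm ?gTS_ge0 // => h.
rewrite -[X in _ * X]ger0_norm ?l1dist_ge0 // -sqrtr_sqr -sqrtrM //.
by rewrite ler_wsqrtr.
Qed.

Lemma dist_bound p : TS3 p -> exists2 C : R, 0 <= C &
  forall z, TS3 z -> l1dist p z <= 1 ->
    (riemannian_dist (@TS3 R) (@gTS R) z p <= (C * l1dist p z)%:E)%E.
Proof.
move=> pM; have [C C0 hC] := speed_bound pM; exists C => // z zM zd.
have hl t' : 0 < lnrm p z t'.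
  by apply: lt_le_trans (lnrm_ge pM zM zd t').
have C1 := ccurve_C1 hl.
apply: (@le_trans _ _ (path_length (@gTS R) [:: ccurve p z])).
  apply: ereal_inf_lbound; exists [:: ccurve p z] => //=.
  by split; [exact: C1 | exact: ccurve0 | exact: ccurve1].
rewrite /path_length big_seq1 /curve_length.
have mI : measurable `[(0 : R), (1 : R)]%classic by exact: measurable_itv.
apply: (@le_trans _ _ (\int[lebesgue_measure]_(x in `[0%R, 1%R])
   (cst (C * l1dist p z)%:E x))%E).
  apply: ge0_le_integral => //.
  - apply/measurable_EFinP; apply: measurable_funTS.
    exact: continuous_measurable_fun (continuous_speed C1).
  - move=> x; rewrite /= in_itv /= => x01; rewrite lee_fin.
    exact: hC.
have L : @lebesgue_measure R `[(0 : R), (1 : R)]%classic = 1%E.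
  by rewrite lebesgue_measure_itv /= lte_fin ltr01 oppr0 adde0.
rewrite integral_cst // [X in (_ * X <= _)%E](_ : _ = 1%E); last exact: L.
by rewrite mule1.
Qed.

Local Open Scope classical_set_scope.
Local Open Scope ring_scope.

Lemma complete_TS3 : complete_metric (@TS3 R) (@gTS R).
Proof.
move=> x xM xC; have [p pM cp] := cauchy_limit xM xC; exists p => // e e0.
have [C C0 hC] := dist_bound pM.
(* The 1 keeps [l1dist] in the range of [dist_bound]; C + 1 makes the quotient meaningful for C = 0
   and gives C r < e strictly. *)
pose r := Num.min 1 (e / (C + 1)).
have C1 : 0 < C + 1 by rewrite ltr_wpDl.
have r0 : 0 < r by rewrite lt_min ltr01 divr_gt0.
(* A 4 by 2 matrix has 8 entries, so r / 8 for each keeps [l1dist] below r. *)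
have H : \forall n \near \oo, forall i j, `|x n i j - p i j| < r / 8.
  apply: (@filter_forall nat 'I_4 (fun i n => forall j, `|x n i j - p i j| < r / 8)
    (nbhs \oo) _) => i.
  apply: (@filter_forall nat 'I_2 (fun j n => `|x n i j - p i j| < r / 8)
    (nbhs \oo) _) => j.
  have := cp i j; move/cvgrPdist_lt => /(_ (r / 8)).
  rewrite divr_gt0 // => /(_ isT).
  by apply: filterS => n; rewrite distrC.
case: H => N _ hN; exists N => n Nn.
have l1 : l1dist p (x n) <= r.
  apply: (@le_trans _ _ (\sum_(i < 4) \sum_(j < 2) (r / 8))).
    by apply: ler_sum => i _; apply: ler_sum => j _; apply/ltW/hN.
  by rewrite !sumr_const !card_ord -mulrnA -mulr_natr; lra.
have rle : r <= 1 by rewrite ge_min lexx.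
have rle' : r <= e / (C + 1) by rewrite ge_min lexx orbT.
apply: le_lt_trans (hC _ (xM n) (le_trans l1 rle)) _.
rewrite lte_fin; apply: (@le_lt_trans _ _ (C * (e / (C + 1)))).
  by rewrite ler_wpM2l // (le_trans l1).
by rewrite mulrA ltr_pdivrMr // mulrC ltr_pM2l // ltrDl.
Qed.

End Completeness.

Theorem mainTheorem2 (R : realType) :
  exists (omega : dform 'M[R]_(4, 2) 2) (psi psih : dform 'M[R]_(4, 2) 3)
         (g : 'M[R]_(4, 2) -> 'M[R]_(4, 2) -> 'M[R]_(4, 2) -> R)
         (J : 'M[R]_(4, 2) -> 'M[R]_(4, 2) -> 'M[R]_(4, 2)),
    SU3_structure (@TS3 R) (@tTS3 R) g J omega psi psih /\
    symplectic_half_flat (@TS3 R) (@tTS3 R) omega psi /\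
    strict (@TS3 R) (@tTS3 R) J omega psih /\
    SO4_invariant omega /\
    SO4_invariant psi /\
    complete_metric (@TS3 R) g.
Proof.
exists (@omega_form R), (@psi_form R), (@psih_form R), (@gTS R), (@JTS R).
split; first exact: SU3_structure_TS3.
split; first by split; [exact: extd_omega | exact: extd_psi].
split; first exact: strict_TS3.
split; first by move=> A SA p w _ _; exact: omega_SO4.
split; first by move=> A SA p w _ _; exact: psi_SO4.
exact: complete_TS3.
Qed.
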